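(* Let $d<n$, let $\alpha\neq 0$ be a real number, and equip the Stiefel manifold $\mathrm{St}_{n,d}$ with the metric $\langle\xi,\xi\rangle=\operatorname{Tr}\xi^{\mathsf T}\xi+(\alpha-1)\operatorname{Tr}\xi^{\mathsf T}YY^{\mathsf T}\xi$ for $\xi\in T_Y\mathrm{St}_{n,d}$. Let $Y\in\mathrm{St}_{n,d}$ and $\xi\in T_Y\mathrm{St}_{n,d}$. Let $k\le d$ be the rank of $\xi-YY^{\mathsf T}\xi$ (the dimension of its column span), and let $Q\in\mathbb R^{n\times k}$ be a matrix whose columns form an orthonormal basis of that span (if $\xi-YY^{\mathsf T}\xi=0$, take $Q=0$, i.e. $k=0$ and all terms with $Q,R$ are absent). Write $\xi=YA+QR$ with $A=Y^{\mathsf T}\xi$ and $R\in\mathbb R^{k\times d}$. Let $\eta\in T_Y\mathrm{St}_{n,d}$ be another tangent vector at $Y$. Then the parallel transport $\Delta(t)$ of $\eta$ along the geodesic $\gamma(t)$ with $\gamma(0)=Y$, $\dot\gamma(0)=\xi$ is $$\Delta(t)=\begin{bmatrix}Y|Q\end{bmatrix}\operatorname{expm}\!\left(t\begin{bmatrix}2\alpha A&-R^{\mathsf T}\\R&0\end{bmatrix}\right)\operatorname{expv}\!\left(t\mathrm P,\begin{bmatrix}Y|Q\end{bmatrix}^{\mathsf T}\eta\right)\operatorname{expm}(t(1-2\alpha)A)+(\eta-YY^{\mathsf T}\eta-QQ^{\mathsf T}\eta)\operatorname{expm}(t(1-\alpha)A).$$ Here $\mathrm P=\mathrm P_{AR}$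 is the linear operator on $\mathcal W:=\mathrm{Skew}_d\times\mathbb R^{k\times d}\subset\mathbb R^{(d+k)\times d}$ mapping $\mathtt W=\begin{bmatrix}\mathtt W_a\\\mathtt W_r\end{bmatrix}$ to $$\mathrm P_{AR}(\mathtt W)=\begin{bmatrix}\big((4\alpha-1)\mathtt W_aA+R^{\mathsf T}\mathtt W_r\big)_{\mathrm{skew}}\\ \alpha(\mathtt W_rA-R\mathtt W_a)\end{bmatrix}.$$
   Context: $\mathrm{St}_{n,d}=\{Y\in\mathbb R^{n\times d}: Y^{\mathsf T}Y=I_d\}$, with tangent space $T_Y\mathrm{St}_{n,d}=\{\xi\in\mathbb R^{n\times d}: Y^{\mathsf T}\xi+\xi^{\mathsf T}Y=0\}$. The metric is given as a quadratic form; the bilinear form is its polarization (it is Riemannian when $\alpha>0$). Geodesics and parallel transport are with respect to the Levi-Civita connection of this metric. $\mathrm{Skew}_d$ is the space of antisymmetric $d\times d$ matrices and $M_{\mathrm{skew}}=\frac12(M-M^{\mathsf T})$. $\operatorname{expm}$ is the matrix exponential. For a linear operator $\mathrm P$ on a finite-dimensional (matrix) vector space and an element $v$ of that space, $\operatorname{expv}(t\mathrm P,v)=e^{t\mathrm P}v=\sum_{j\ge0}\frac{t^j}{j!}\mathrm P^jv$. $[Y|Q]$ denotes horizontal concatenation. *)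

(* Defs.v *)
From HB Require Import structures.
From mathcomp Require Import all_boot all_order all_algebra.
From mathcomp Require Import all_classical all_reals all_analysis.

Set Implicit Arguments.
Unset Strict Implicit.
Unset Printing Implicit Defensive.

Import Order.TTheory GRing.Theory Num.Theory.
Import numFieldNormedType.Exports.

Local Open Scope ring_scope.
Local Open Scope classical_set_scope.

Definition iter_derive (K : realType) (V W : normedModType K)
    (vs : seq V) (f : V -> W) : V -> W :=
  foldr (fun v (g : V -> W) x => 'D_v g x) f vs.

(* C^oo on the whole space: every iterated directional derivative exists and
   is (Frechet) differentiable everywhere. *)
Definition smooth (K : realType) (V W : normedModType K) (f : V -> W) : Prop :=
  forall (vs : seq V) (x : V), differentiable (iter_derive vs f) x.

(* Differential geometry of a closed embedded submanifold M of a
   finite-dimensional normed space E, with tangent spaces T x, and a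
   (pseudo-)Riemannian metric g x : T x * T x -> K.  A smooth function or
   field on M is the restriction to M of a smooth map on E (every smooth
   function on a closed submanifold has such an extension); since v is tangent,
   the ambient derivative along v of an extension only depends on the values
   on M. *)
Section EmbeddedSubmanifold.
Context (K : realType) (E : normedModType K).
Variables (M : set E) (T : E -> set E) (g : E -> E -> E -> K).

Definition vector_field (Z : E -> E) : Prop :=
  smooth Z /\ (forall x, M x -> T x (Z x)).

(* [nabla x v Z] is the value at x of the covariant derivative of Z in the
   direction v; it is constrained only for x in M, v tangent at x, and Z a
   vector field, and depends on Z only through its restriction to M. *)
Record affine_connection (nabla : E -> E -> (E -> E) -> E) : Prop := {
  connection_ext : forall (Z Z' : E -> E) (x v : E),
    vector_field Z -> vector_field Z' -> (forall y, M y -> Z y = Z' y) ->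
    M x -> T x v -> nabla x v Z = nabla x v Z';
  connection_smooth : forall X Z : E -> E,
    vector_field X -> vector_field Z ->
    exists2 F : E -> E, vector_field F &
      forall x, M x -> F x = nabla x (X x) Z;
  connection_tangent : forall (Z : E -> E) (x v : E),
    vector_field Z -> M x -> T x v -> T x (nabla x v Z);
  connection_linear : forall (Z : E -> E) (x u v : E) (a : K),
    vector_field Z -> M x -> T x u -> T x v ->
    nabla x (a *: u + v) Z = a *: nabla x u Z + nabla x v Z;
  connection_add : forall (Z Z' : E -> E) (x v : E),
    vector_field Z -> vector_field Z' -> M x -> T x v ->
    nabla x v (fun y => Z y + Z' y) = nabla x v Z + nabla x v Z';
  connection_leibniz : forall (f : E -> K) (Z : E -> E) (x v : E),
    smooth f -> vector_field Z -> M x -> T x v ->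
    nabla x v (fun y => f y *: Z y) = 'D_v f x *: Z x + f x *: nabla x v Z
}.

(* The right-hand side is the Lie bracket [X, Z] at x. *)
Definition torsion_free (nabla : E -> E -> (E -> E) -> E) : Prop :=
  forall (X Z : E -> E) (x : E), vector_field X -> vector_field Z -> M x ->
    nabla x (X x) Z - nabla x (Z x) X = 'D_(X x) Z x - 'D_(Z x) X x.

Definition metric_compatible (nabla : E -> E -> (E -> E) -> E) : Prop :=
  forall (X Z : E -> E) (x v : E), vector_field X -> vector_field Z ->
    M x -> T x v ->
    'D_v (fun y => g y (X y) (Z y)) x =
      g x (nabla x v X) (Z x) + g x (X x) (nabla x v Z).

Definition levi_civita (nabla : E -> E -> (E -> E) -> E) : Prop :=
  [/\ affine_connection nabla, torsion_free nabla & metric_compatible nabla].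

Definition curve_in (c : K -> E) : Prop := smooth c /\ (forall t, M (c t)).

Definition field_along (c V : K -> E) : Prop :=
  smooth V /\ (forall t, T (c t) (V t)).

(* The covariant derivative D/dt along the curve c induced by nabla: the unique
   additive operator on smooth tangent fields along c that obeys the product
   rule and agrees with nabla on restrictions of vector fields of M. *)
Record covariant_derivative_along (nabla : E -> E -> (E -> E) -> E)
    (c : K -> E) (D : (K -> E) -> K -> E) : Prop := {
  along_field : forall V, field_along c V -> field_along c (D V);
  along_add : forall (V W : K -> E) (t : K),
    field_along c V -> field_along c W ->
    D (fun s => V s + W s) t = D V t + D W t;
  along_leibniz : forall (f : K -> K) (V : K -> E) (t : K),
    smooth f -> field_along c V ->
    D (fun s => f s *: V s) t = derive1 f t *: V t + f t *: D V t;
  along_restrict : forall (Z : E -> E) (t : K),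
    vector_field Z -> D (Z \o c) t = nabla (c t) (derive1 c t) Z
}.

Definition parallel_along (nabla : E -> E -> (E -> E) -> E)
    (c V : K -> E) : Prop :=
  field_along c V /\
  exists2 D, covariant_derivative_along nabla c D & forall t, D V t = 0.

Definition geodesic (nabla : E -> E -> (E -> E) -> E) (c : K -> E) : Prop :=
  curve_in c /\ parallel_along nabla c (derive1 c).

Definition parallel_transport (nabla : E -> E -> (E -> E) -> E)
    (c : K -> E) (eta : E) (V : K -> E) : Prop :=
  parallel_along nabla c V /\ V 0 = eta.

End EmbeddedSubmanifold.

Section Stiefel.
Context (K : realType) (n d : nat).
Implicit Types Y xi eta : 'M[K]_(n, d).

Definition stiefel : set 'M[K]_(n, d) := [set Y | Y^T *m Y = 1%:M].

Definition stiefel_tangent Y : set 'M[K]_(n, d) :=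
  [set xi | Y^T *m xi + xi^T *m Y = 0].

Definition stiefel_qform (alpha : K) Y xi : K :=
  \tr (xi^T *m xi) + (alpha - 1) * \tr (xi^T *m Y *m Y^T *m xi).

(* The polarization of the quadratic form. *)
Definition stiefel_metric (alpha : K) Y xi eta : K :=
  (stiefel_qform alpha Y (xi + eta) - stiefel_qform alpha Y xi
     - stiefel_qform alpha Y eta) / 2.

End Stiefel.

Definition expm (K : realType) (m : nat) (B : 'M[K]_m) : 'M[K]_m :=
  limn (series (fun j => (j`!%:R)^-1 *: B ^+ j)).

(* exp (t P) applied to w. *)
Definition expv (K : realType) (V : normedModType K)
    (t : K) (P : V -> V) (w : V) : V :=
  limn (series (fun j => (t ^+ j / j`!%:R) *: iter j P w)).

Definition skew_part (K : realType) (d : nat) (B : 'M[K]_d) : 'M[K]_d :=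
  2^-1 *: (B - B^T).

(* The formula makes sense on all of K^((d + k) x d); the subspace
   Skew_d x K^(k x d) is stable under it (P_AR_skew), so the exponential
   computed in the ambient space restricts to the one on that subspace. *)
Definition P_AR (K : realType) (d k : nat) (alpha : K)
    (A : 'M[K]_d) (R : 'M[K]_(k, d)) (W : 'M[K]_(d + k, d)) :
    'M[K]_(d + k, d) :=
  col_mx
    (skew_part ((4 * alpha - 1) *: (usubmx W *m A) + R^T *m dsubmx W))
    (alpha *: (dsubmx W *m A - R *m usubmx W)).

Lemma P_AR_skew (K : realType) (d k : nat) (alpha : K)
    (A : 'M[K]_d) (R : 'M[K]_(k, d)) (W : 'M[K]_(d + k, d)) :
  (usubmx (P_AR alpha A R W))^T = - usubmx (P_AR alpha A R W).
Proof.
by rewrite /P_AR col_mxKu /skew_part linearZ/= linearB/= trmxK -scalerN opprB.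
Qed.

(* Main.v *)
Require Import Defs.
From HB Require Import structures.
From mathcomp Require Import all_boot all_order all_algebra.
From mathcomp Require Import all_classical all_reals all_analysis.
From mathcomp Require Import ring lra.

Set Implicit Arguments.
Unset Strict Implicit.
Unset Printing Implicit Defensive.

Import Order.TTheory GRing.Theory Num.Theory.
Import numFieldNormedType.Exports.

Local Open Scope ring_scope.
Local Open Scope classical_set_scope.

(** Write G_x(u, w) for the bilinear expression

      1/2 x (u^T w + w^T u) + (1 - alpha) (I - x x^T) (u w^T + w u^T) x.

    Adding G_x(v, Z x) to the ambient derivative of a vector field Z along v
    gives a torsion-free connection that preserves the metric
    ([stiefel_nabla_tangent], [stiefel_nabla_compatible]).  As alpha is nonzero
    the metric is nondegenerate on tangent spaces, so the Koszul argument
    identifies this connection with any Levi-Civita connection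
    ([levi_civita_stiefelE]).  The tangent bundle is spanned by finitely many
    global polynomial fields, hence the covariant derivative along a curve c is
    determined by its defining rules, and V is parallel along c exactly when
    V' + G_c(c', V) = 0 ([parallel_alongP]).

    Along a geodesic two quantities are conserved because O(n) and O(d) act by
    isometries on the left and on the right: the skew matrices A = c^T c' and
    Om = c' c^T - c c'^T + 2 (alpha - 1) c A c^T.  They turn the nonlinear
    geodesic equation into the linear one c' = Om c + (1 - 2 alpha) c A, so

      c(t) = exp(t Om) c(0) exp(t (1 - 2 alpha) A)      ([geodesic_expm]).

    Both factors are isometries that carry c(0), c'(0) to c(t), c'(t).  Seen in
    this moving frame, that is for Delta = exp(t Om) W exp(t (1 - 2 alpha) A),
    the parallel equation has constant coefficients: W' = L W with a linear
    operator L ([parallel_moving_frame]).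

    It remains to compute exp(t L) on eta.  The matrices [Y|Q] w with a skew
    upper block in w form a subspace where L acts as P_AR on w
    ([frame_operator_block]), while on the matrices whose columns are orthogonal
    to those of [Y|Q] the operator L is right multiplication by alpha A
    ([frame_operator_orthogonal]).  Finally Om preserves the span of [Y|Q],
    where it has the block matrix of the statement ([momentum_row_mx]), and it
    kills the orthogonal complement; moving exp(t Om) through the two summands
    gives the formula ([transport_formulaE]). *)

(** * Calculus of matrix-valued maps *)

Section MatrixCalculus.
Context (K : realType).

Lemma cvg_mxP (T : Type) (F : set_system T) (FF : Filter F) m n
    (f : T -> 'M[K]_(m, n)) (l : 'M[K]_(m, n)) :
  (f x @[x --> F] --> l) <-> forall i j, f x i j @[x --> F] --> l i j.
Proof.
split=> [fl i j|fl].
  exact: (cvg_comp _ _ fl (@coord_continuous K m n i j l)).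
move=> S [P lP PS].
apply: (@filterS _ F FF (fun x => forall i j, P i j (f x i j))) => [x|].
  exact: PS.
by apply: filter_forall => i; apply: filter_forall => j; exact: fl.
Qed.

Lemma differentiable_bigsum (V W : normedModType K) m (f : 'I_m -> V -> W) x :
  (forall i, differentiable (f i) x) ->
  differentiable (fun y => \sum_(i < m) f i y) x.
Proof.
move=> fd; have -> : (fun y => \sum_(i < m) f i y) = \sum_(i < m) f i.
  by apply/funext => y; rewrite fct_sumE.
exact: differentiable_sum.
Qed.

Lemma is_derive_bigsum (V W : normedModType K) m (f : 'I_m -> V -> W) x v df :
  (forall i, is_derive x v (f i) (df i)) ->
  is_derive x v (fun y => \sum_(i < m) f i y) (\sum_(i < m) df i).
Proof.
move=> fd; have -> : (fun y => \sum_(i < m) f i y) = \sum_(i < m) f i.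
  by apply/funext => y; rewrite fct_sumE.
exact: is_derive_sum.
Qed.

Lemma linear_mx_continuous m n (W : normedModType K)
    (L : {linear 'M[K]_(m, n) -> W}) : continuous L.
Proof.
move=> M.
have LE : (L : _ -> W) =
    (fun X => \sum_(i < m) \sum_(j < n) X i j *: L (delta_mx i j)).
  apply/funext => X; rewrite [in LHS](matrix_sum_delta X) linear_sum.
  apply: eq_bigr => i _; rewrite linear_sum.
  by apply: eq_bigr => j _; rewrite linearZ.
rewrite LE.
apply/differentiable_continuous/differentiable_bigsum => i.
apply: differentiable_bigsum => j.
exact/differentiableZl/differentiable_coord.
Qed.

Lemma is_derive_linear (V W W' : normedModType K) (L : {linear W -> W'})
    (f : V -> W) (x v : V) (df : W) :
  continuous L -> is_derive x v f df -> is_derive x v (L \o f) (L df).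
Proof.
move=> Lc [fd fE].
have H : h^-1 *: (((L \o f) \o shift x) (h *: v) - (L \o f) x)
           @[h --> 0^'] --> L df.
  rewrite -fE /derive.
  have := cvg_comp _ _ fd (Lc _).
  rewrite /comp/=; apply: cvg_trans; apply: near_eq_cvg; near=> h.
  by rewrite /= linearZ linearB.
by split; [apply/cvg_ex; exists (L df)|apply: cvg_lim].
Unshelve. all: by end_near. Qed.

Lemma is_derive_mx (V : normedModType K) m n (M : V -> 'M[K]_(m, n)) x v
    (dM : 'M[K]_(m, n)) :
  (forall i j, is_derive x v (fun y => M y i j) (dM i j)) ->
  is_derive x v M dM.
Proof.
move=> H; have Md : derivable M x v by apply/derivable_mxP => i j.
split=> //; rewrite derive_mx //; apply/matrixP => i j; rewrite mxE.
exact: derive_val.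
Qed.

Lemma is_derive_coord (V : normedModType K) m n (M : V -> 'M[K]_(m, n))
    x v (dM : 'M[K]_(m, n)) i j :
  is_derive x v M dM -> is_derive x v (fun y => M y i j) (dM i j).
Proof.
move=> [Md <-].
have Mijd : derivable (fun y => M y i j) x v by move/derivable_mxP: Md.
by rewrite derive_mx// mxE; apply/derivableP.
Qed.

Lemma is_derive_mulmx (V : normedModType K) m n p (M : V -> 'M[K]_(m, n))
    (N : V -> 'M[K]_(n, p)) x v (dM : 'M[K]_(m, n)) (dN : 'M[K]_(n, p)) :
  is_derive x v M dM -> is_derive x v N dN ->
  is_derive x v (fun y => M y *m N y) (dM *m N x + M x *m dN).
Proof.
move=> HM HN; apply: is_derive_mx => i j.
have -> : (fun y => (M y *m N y) i j) =
          (fun y => \sum_(k < n) ((fun y => M y i k) * (fun y => N y k j)) y).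
  by apply/funext => y; rewrite mxE.
have -> : (dM *m N x + M x *m dN) i j =
    \sum_(k < n) (M x i k *: dN k j + N x k j *: dM i k).
  rewrite !mxE -big_split /=; apply: eq_bigr => k _.
  by rewrite /GRing.scale/= addrC [N x k j * _]mulrC.
apply: is_derive_bigsum => k.
by apply: is_deriveM; exact: is_derive_coord.
Qed.

Lemma differentiable_mx (V : normedModType K) m n (M : V -> 'M[K]_(m, n)) x :
  (forall i j, differentiable (fun y => M y i j) x) -> differentiable M x.
Proof.
move=> H.
have -> : M = (fun y => \sum_(i < m) \sum_(j < n) M y i j *: delta_mx i j).
  by apply/funext => y; exact: matrix_sum_delta.
apply: differentiable_bigsum => i; apply: differentiable_bigsum => j.
exact: differentiableZl.
Qed.

Lemma differentiable_mx_coord (V : normedModType K) m n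
    (M : V -> 'M[K]_(m, n)) x i j :
  differentiable M x -> differentiable (fun y => M y i j) x.
Proof.
move=> Md.
exact: (differentiable_comp Md (differentiable_coord (M x) i j)).
Qed.

Lemma differentiable_mulmx (V : normedModType K) m n p
    (M : V -> 'M[K]_(m, n)) (N : V -> 'M[K]_(n, p)) x :
  differentiable M x -> differentiable N x ->
  differentiable (fun y => M y *m N y) x.
Proof.
move=> HM HN; apply: differentiable_mx => i j.
have -> : (fun y => (M y *m N y) i j) =
          (fun y => \sum_(k < n) ((fun y => M y i k) * (fun y => N y k j)) y).
  by apply/funext => y; rewrite mxE.
apply: differentiable_bigsum => k.
by apply: differentiableM; exact: differentiable_mx_coord.
Qed.

Lemma is_derive_linear_mx m n p q (L : {linear 'M[K]_(m, n) -> 'M[K]_(p, q)})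
    (X : K -> 'M[K]_(m, n)) (t : K) (dX : 'M[K]_(m, n)) :
  is_derive t (1 : K) X dX -> is_derive t (1 : K) (fun s => L (X s)) (L dX).
Proof. by apply: is_derive_linear; exact: linear_mx_continuous. Qed.

Lemma is_derive_mxtrace (V : normedModType K) m (A : V -> 'M[K]_m) x v
    (dA : 'M[K]_m) :
  is_derive x v A dA -> is_derive x v (fun y => \tr (A y)) (\tr dA).
Proof.
by move=> Ad; apply: is_derive_bigsum => i; exact: is_derive_coord.
Qed.

Lemma is_derive_trmx (V : normedModType K) m p (A : V -> 'M[K]_(m, p)) x v
    (dA : 'M[K]_(m, p)) :
  is_derive x v A dA -> is_derive x v (fun y => (A y)^T) (dA^T).
Proof.
move=> Ad; apply: is_derive_mx => i j; rewrite mxE.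
rewrite (_ : (fun y => (A y)^T i j) = (fun y => A y j i)).
  exact: is_derive_coord.
by apply/funext => y; rewrite mxE.
Qed.

Lemma is_derive_comp_curve (W E : normedModType K) (Z : E -> W) (c : K -> E)
    (t : K) (v : E) :
  is_derive t (1 : K) c v -> differentiable Z (c t) ->
  is_derive t (1 : K) (Z \o c) ('D_v Z (c t)).
Proof.
move=> [cd <-] Zd.
have cD : differentiable c t by apply/derivable1_diffP.
have ZcD : differentiable (Z \o c) t by exact: differentiable_comp.
split; first exact: diff_derivable.
by rewrite deriveE// diff_comp// /= [in RHS]deriveE// deriveE.
Qed.

End MatrixCalculus.

(** * Smooth maps *)

Section Smooth.
Context (K : realType).

(** Recursion on the order of differentiation fits the product rule: a
    derivative of a product is a sum of products whose factors are smooth to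
    one order less, whereas a fixed list of directions would have to be
    distributed over both factors. *)
Fixpoint smooth_upto (V W : normedModType K) (r : nat) (f : V -> W) : Prop :=
  (forall x, differentiable f x) /\
  (if r is r'.+1 then forall v, smooth_upto r' ('D_v f) else True).

Lemma smoothP (V W : normedModType K) (f : V -> W) :
  smooth f <-> forall r, smooth_upto r f.
Proof.
split=> [fs r|fs].
  elim: r f fs => [|r IHr] f fs; split=> //; try exact: (fs [::]).
  move=> v; apply: IHr => vs x.
  by move: (fs (rcons vs v) x); rewrite /iter_derive foldr_rcons.
move=> vs; elim/last_ind: vs f fs => [|vs v IHvs] f fs x.
  by case: (fs 0%N) => + _; exact.
rewrite /iter_derive foldr_rcons; apply: IHvs => r.
by case: (fs r.+1) => _; exact.
Qed.

Lemma smooth_uptoW (V W : normedModType K) r (f : V -> W) :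
  smooth_upto r.+1 f -> smooth_upto r f.
Proof.
elim: r f => [|r IHr] f [fd fD]; split=> // v; exact: IHr.
Qed.

Lemma smooth_differentiable (V W : normedModType K) (f : V -> W) x :
  smooth f -> differentiable f x.
Proof. by move=> fs; exact: (fs [::]). Qed.

Lemma smooth_derive (V W : normedModType K) (f : V -> W) v :
  smooth f -> smooth ('D_v f).
Proof.
by move=> fs vs x; move: (fs (rcons vs v) x); rewrite /iter_derive foldr_rcons.
Qed.

Lemma smooth_derive1 (W : normedModType K) (f : K -> W) :
  smooth f -> smooth (derive1 f).
Proof.
move=> fs; have -> : derive1 f = 'D_1 f by apply/funext => x; rewrite derive1E.
exact: smooth_derive.
Qed.

Lemma smooth_cst (V W : normedModType K) (c : W) : smooth (fun _ : V => c).
Proof.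
apply/smoothP => r; elim: r c => [|r IHr] c.
  by split=> // x; exact: differentiable_cst.
split=> [x|v]; first exact: differentiable_cst.
have -> : 'D_v (fun _ : V => c) = (fun _ => 0).
  by apply/funext => x; exact: derive_cst.
exact: IHr.
Qed.

Lemma smooth_uptoD (V W : normedModType K) r (f g : V -> W) :
  smooth_upto r f -> smooth_upto r g -> smooth_upto r (fun y => f y + g y).
Proof.
elim: r f g => [|r IHr] f g [fd fD] [gd gD].
  by split=> // x; exact: differentiableD.
split=> [x|v]; first exact: differentiableD.
have -> : 'D_v (fun y => f y + g y) = (fun y => 'D_v f y + 'D_v g y).
  by apply/funext => x; apply: deriveD; exact: diff_derivable.
exact: (IHr _ _ (fD v) (gD v)).
Qed.

Lemma smoothD (V W : normedModType K) (f g : V -> W) :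
  smooth f -> smooth g -> smooth (fun y => f y + g y).
Proof.
by move=> /smoothP fs /smoothP gs; apply/smoothP => r; exact: smooth_uptoD.
Qed.

Lemma smooth_linear_comp (V W W' : normedModType K) (L : {linear W -> W'})
    (f : V -> W) :
  continuous L -> smooth f -> smooth (fun y => L (f y)).
Proof.
move=> Lc fs; apply/smoothP => r; move/smoothP: fs => /(_ r).
have Ld h x : differentiable h x -> differentiable (fun y : V => L (h y)) x.
  by move=> hd; apply: (differentiable_comp hd); exact: linear_differentiable.
elim: r f => [|r IHr] f [fd fD].
  by split=> // x; exact: Ld.
split=> [x|v]; first exact: Ld.
have -> : 'D_v (fun y => L (f y)) = (fun y => L ('D_v f y)).
  apply/funext => x; apply: derive_val.
  by apply: is_derive_linear => //; apply/derivableP/diff_derivable.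
exact: (IHr _ (fD v)).
Qed.

Lemma smooth_id (V : normedModType K) : smooth (@id V).
Proof.
apply/smoothP => -[|r]; first by split.
split=> // v; have -> : 'D_v (@id V) = (fun _ => v).
  by apply/funext => x; rewrite derive_id.
by have /smoothP := @smooth_cst V V v.
Qed.

Lemma smooth_mulmx (V : normedModType K) m n p (M : V -> 'M[K]_(m, n))
    (N : V -> 'M[K]_(n, p)) :
  smooth M -> smooth N -> smooth (fun y => M y *m N y).
Proof.
move=> /smoothP Ms /smoothP Ns; apply/smoothP => r.
move: (Ms r) (Ns r) => {Ms Ns}; elim: r M N => [|r IHr] M N [Md MD] [Nd ND].
  by split=> // x; exact: differentiable_mulmx.
split=> [x|v]; first exact: differentiable_mulmx.
have -> : 'D_v (fun y => M y *m N y) =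
          (fun y => 'D_v M y *m N y + M y *m 'D_v N y).
  apply/funext => x; apply: derive_val; apply: is_derive_mulmx;
  exact/derivableP/diff_derivable.
apply: smooth_uptoD.
  by apply: (IHr _ _ (MD v)); apply: smooth_uptoW; split.
by apply: (fun H => IHr _ _ H (ND v)); apply: smooth_uptoW; split.
Qed.

Lemma smoothN (V W : normedModType K) (f : V -> W) :
  smooth f -> smooth (fun y => - f y).
Proof.
apply: (@smooth_linear_comp V W W -%R) => x.
exact: opp_continuous.
Qed.

Lemma smoothZ (V W : normedModType K) (a : K) (f : V -> W) :
  smooth f -> smooth (fun y => a *: f y).
Proof.
apply: (@smooth_linear_comp V W W ( *:%R a)) => x.
exact: scaler_continuous.
Qed.

Lemma smooth_trmx (V : normedModType K) m n (M : V -> 'M[K]_(m, n)) :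
  smooth M -> smooth (fun y => (M y)^T).
Proof.
apply: (@smooth_linear_comp V _ _ (@trmx K m n)).
exact: linear_mx_continuous.
Qed.

Lemma smooth_coord (V : normedModType K) m n (M : V -> 'M[K]_(m, n)) i j :
  smooth M -> smooth (fun y => M y i j).
Proof.
have cl : linear (fun X : 'M[K]_(m, n) => X i j : K^o).
  by move=> a X Z; rewrite !mxE.
pose cL := HB.pack_for {linear 'M[K]_(m, n) -> K^o}
  (fun X : 'M[K]_(m, n) => X i j : K^o)
  (GRing.isLinear.Build _ _ _ _ _ cl).
apply: (@smooth_linear_comp V _ _ cL) => X.
exact: coord_continuous.
Qed.

Lemma smooth_scale (V : normedModType K) m n (f : V -> K)
    (M : V -> 'M[K]_(m, n)) :
  smooth f -> smooth M -> smooth (fun y => f y *: M y).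
Proof.
move=> fs Ms.
have -> : (fun y => f y *: M y) = (fun y => (f y)%:M *m M y).
  by apply/funext => y; rewrite mul_scalar_mx.
apply: smooth_mulmx => //.
have cl : linear (fun a : K^o => a%:M : 'M[K]_m).
  by move=> a x z; rewrite raddfD/= scale_scalar_mx.
pose cL := HB.pack_for {linear K^o -> 'M[K]_m} (fun a : K^o => a%:M : 'M[K]_m)
  (GRing.isLinear.Build _ _ _ _ _ cl).
apply: (@smooth_linear_comp V _ _ cL) => // x.
apply/differentiable_continuous/differentiable_mx => i j.
have -> : (fun y : K => (cL y) i j) = (fun y : K => (i == j)%:R *: y).
  by apply/funext => y; rewrite /= mxE; exact/esym/mulr_natl.
exact/differentiableZ.
Qed.

Lemma smooth_is_derive1 (W : normedModType K) (f : K -> W) (t : K) :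
  smooth f -> is_derive t (1 : K) f (derive1 f t).
Proof.
move=> fs; rewrite derive1E; apply/derivableP/diff_derivable.
exact: smooth_differentiable.
Qed.

Lemma is_derive1E (W : normedModType K) (f : K -> W) (t : K) (df : W) :
  is_derive t (1 : K) f df -> derive1 f t = df.
Proof. by move=> [_ <-]; rewrite derive1E. Qed.

End Smooth.

(** * The matrix exponential *)

Section MatrixExponential.
Context (K : realType).

Lemma cvg_linear_mx m n p q (L : {linear 'M[K]_(m, n) -> 'M[K]_(p, q)})
    (u : nat -> 'M[K]_(m, n)) l :
  u @ \oo --> l -> L (u N) @[N --> \oo] --> L l.
Proof. by move=> ul; apply: cvg_comp ul _; exact: linear_mx_continuous. Qed.

(** Each entry of t |-> expm (t *: B) is a power series in t, and these are its
    coefficients; convergence and differentiation of expm are thereby inherited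
    from scalar power series. *)
Definition expm_coeff m (B : 'M[K]_m) i k (j : nat) : K :=
  j`!%:R^-1 * (B ^+ j) i k.

Lemma expmx_entry_bound m (B : 'M[K]_m) :
  exists2 C : K, 0 <= C & forall j i k, `|(B ^+ j) i k| <= C ^+ j.
Proof.
pose b := \sum_i \sum_k `|B i k|.
have b0 : 0 <= b by apply: sumr_ge0 => i _; apply: sumr_ge0.
have Bb i k : `|B i k| <= b.
  rewrite /b (bigD1 i)//= (bigD1 k)//= -addrA lerDl addr_ge0// sumr_ge0//.
  by move=> l _; exact: sumr_ge0.
exists (m%:R * b) => [|j]; first by rewrite mulr_ge0.
elim: j => [|j IHj] i k.
  by rewrite expr0 /GRing.one/= mxE; case: eqP => _; rewrite ?normr1 ?normr0.
rewrite !exprS -mulmxE mxE (le_trans (ler_norm_sum _ _ _))//.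
apply: (@le_trans _ _ (\sum_(l < m) b * (m%:R * b) ^+ j)).
  by apply: ler_sum => l _; rewrite normrM ler_pM.
by rewrite sumr_const card_ord -[leLHS]mulr_natl mulrA.
Qed.

Lemma expm_coeff_cvg m (B : 'M[K]_m) i k t :
  cvgn (pseries (expm_coeff B i k) t).
Proof.
have [C C0 BC] := expmx_entry_bound B.
apply: normed_cvg.
apply: (@series_le_cvg _ _ (exp_coeff (C * `|t|))) => [n|n|n|].
- exact: normr_ge0.
- by apply: exp_coeff_ge0; rewrite mulr_ge0.
- rewrite /expm_coeff /exp_coeff/= !normrM normfV normr_nat normrX exprMn.
  by rewrite -mulrA mulrC ler_wpM2r ?invr_ge0// ler_wpM2r ?exprn_ge0.
- exact: is_cvg_series_exp_coeff.
Qed.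

Lemma exprmxZ m (B : 'M[K]_m) (t : K) j : (t *: B) ^+ j = t ^+ j *: B ^+ j.
Proof.
elim: j => [|j IHj]; first by rewrite !expr0 scale1r.
by rewrite !exprS IHj -!mulmxE -scalemxAl -scalemxAr scalerA.
Qed.

Lemma expm_seriesE m (B : 'M[K]_m) t (N : nat) i k :
  series (fun j => (j`!%:R)^-1 *: (t *: B) ^+ j) N i k =
  pseries (expm_coeff B i k) t N.
Proof.
rewrite /series /pseries /series /= summxE; apply: eq_bigr => j _.
by rewrite exprmxZ !mxE /expm_coeff mulrCA mulrC.
Qed.

Lemma expm_cvg_scale m (B : 'M[K]_m) t :
  series (fun j => (j`!%:R)^-1 *: (t *: B) ^+ j) @ \oo --> expm (t *: B).
Proof.
suff : cvgn (series (fun j => (j`!%:R)^-1 *: (t *: B) ^+ j)) by [].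
apply/cvg_ex; exists (\matrix_(i, k) limn (pseries (expm_coeff B i k) t)).
apply/cvg_mxP => i k; rewrite mxE.
rewrite (_ : (fun x => _) = pseries (expm_coeff B i k) t); last first.
  by apply/funext => N; exact: expm_seriesE.
exact: expm_coeff_cvg.
Qed.

Lemma expm_cvg m (B : 'M[K]_m) :
  series (fun j => (j`!%:R)^-1 *: B ^+ j) @ \oo --> expm B.
Proof. by rewrite -[B]scale1r; exact: expm_cvg_scale. Qed.

Lemma expmE m (B : 'M[K]_m) t i k :
  expm (t *: B) i k = limn (pseries (expm_coeff B i k) t).
Proof.
apply/esym/cvg_lim => //.
rewrite (_ : pseries _ _ = (fun N =>
  series (fun j => (j`!%:R)^-1 *: (t *: B) ^+ j) N i k)); last first.
  by apply/funext => N; rewrite expm_seriesE.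
by move: i k; apply/cvg_mxP; exact: expm_cvg_scale.
Qed.

(** Whatever intertwines two matrices intertwines their powers, hence, in the
    limit, their exponentials. *)
Lemma expm_intertwine m p (B : 'M[K]_m) (B' : 'M[K]_p) (C : 'M[K]_(m, p)) :
  B *m C = C *m B' -> expm B *m C = C *m expm B'.
Proof.
move=> BC.
have BCj j : B ^+ j *m C = C *m B' ^+ j.
  elim: j => [|j IHj]; first by rewrite !expr0 [RHS]mulmx1; exact: mul1mx.
  by rewrite !exprSr -!mulmxE -mulmxA BC mulmxA IHj mulmxA.
have L1 : (series (fun j => (j`!%:R)^-1 *: B ^+ j) N *m C) @[N --> \oo] -->
    expm B *m C.
  exact: (@cvg_linear_mx _ _ _ _ (mulmxr C) _ _ (@expm_cvg _ B)).
have L2 : (C *m series (fun j => (j`!%:R)^-1 *: B' ^+ j) N) @[N --> \oo] -->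
    C *m expm B'.
  exact: (@cvg_linear_mx _ _ _ _ (mulmx C) _ _ (@expm_cvg _ B')).
have E : (fun N => series (fun j => (j`!%:R)^-1 *: B ^+ j) N *m C) =
         (fun N => C *m series (fun j => (j`!%:R)^-1 *: B' ^+ j) N).
  apply/funext => N; rewrite /series/= mulmx_suml mulmx_sumr.
  by apply: eq_bigr => j _; rewrite -scalemxAl -scalemxAr BCj.
by rewrite E in L1; apply: (cvg_unique _ L1 L2).
Qed.

Lemma expm_tr m (B : 'M[K]_m) : (expm B)^T = expm B^T.
Proof.
have L1 : (series (fun j => (j`!%:R)^-1 *: B ^+ j) N)^T @[N --> \oo] -->
    (expm B)^T.
  exact: (@cvg_linear_mx _ _ _ _ (@trmx K m m) _ _ (@expm_cvg _ B)).
have E : (fun N => (series (fun j => (j`!%:R)^-1 *: B ^+ j) N)^T) =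
         series (fun j => (j`!%:R)^-1 *: B^T ^+ j).
  apply/funext => N; rewrite /series/= linear_sum; apply: eq_bigr => j _.
  rewrite /= linearZ/=; congr (_ *: _).
  elim: j => [|j IHj]; first by rewrite !expr0 trmx1.
  by rewrite exprSr exprS -!mulmxE trmx_mul IHj.
by rewrite E in L1; apply: (cvg_unique _ L1 (@expm_cvg _ B^T)).
Qed.

Lemma expm0 m : expm (0 : 'M[K]_m) = 1%:M.
Proof.
apply: cvg_lim; first exact: norm_hausdorff.
rewrite -(cvg_shiftS _ _).
rewrite (_ : (fun N => _) = (fun=> 1%:M)); first exact: cvg_cst.
apply/funext => N; rewrite /series/= big_nat_recl// expr0 fact0 invr1 scale1r.
rewrite big1 ?addr0// => j _.
by rewrite exprS mul0r scaler0.
Qed.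

Lemma expm_coeff_diffs m (B : 'M[K]_m) i k j :
  pseries_diffs (expm_coeff B i k) j = \sum_l B i l * expm_coeff B l k j.
Proof.
rewrite /pseries_diffs /expm_coeff factS natrM invfM !mulrA mulfV// mul1r.
rewrite exprS -mulmxE mxE mulr_sumr; apply: eq_bigr => l _.
by rewrite mulrCA.
Qed.

(** Differentiating an entry series formally is the same as multiplying the
    matrix of series by B on the left, so the convergence of expm itself gives
    the convergence of the differentiated series. *)
Lemma expm_coeff_diffs_cvg m (B : 'M[K]_m) i k t :
  pseries (pseries_diffs (expm_coeff B i k)) t @ \oo -->
  (B *m expm (t *: B)) i k.
Proof.
have L : (B *m series (fun j => (j`!%:R)^-1 *: (t *: B) ^+ j) N) @[N --> \oo]
    --> B *m expm (t *: B).
  exact: (@cvg_linear_mx _ _ _ _ (mulmx B) _ _ (@expm_cvg_scale _ B t)).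
move/cvg_mxP : L => /(_ i k).
rewrite (_ : (fun N => _) = pseries (pseries_diffs (expm_coeff B i k)) t)//.
apply/funext => N; rewrite mxE /pseries /series/=.
under [RHS]eq_bigr do rewrite expm_coeff_diffs mulr_suml.
rewrite exchange_big/=; apply: eq_bigr => l _.
have := expm_seriesE B t N l k; rewrite /series/= => ->.
by rewrite /pseries /series/= mulr_sumr; apply: eq_bigr => j _; rewrite mulrA.
Qed.

Lemma is_derive_expm m (B : 'M[K]_m) (t : K) :
  is_derive t (1 : K) (fun s : K => expm (s *: B)) (B *m expm (t *: B)).
Proof.
apply: is_derive_mx => i k.
have -> : (fun s => expm (s *: B) i k) =
          (fun s => limn (pseries (expm_coeff B i k) s)).
  by apply/funext => s; exact: expmE.
have <- : limn (pseries (pseries_diffs (expm_coeff B i k)) t) =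
    (B *m expm (t *: B)) i k.
  by apply: cvg_lim => //; exact: expm_coeff_diffs_cvg.
(* any radius beyond |t| works *)
apply: (@pseries_snd_diffs _ _ (`|t| + 1)).
- exact: expm_coeff_cvg.
- by apply/cvg_ex; eexists; exact: expm_coeff_diffs_cvg.
- rewrite (_ : pseries_diffs _ = fun j =>
    \sum_l B i l * pseries_diffs (expm_coeff B l k) j); last first.
    apply/funext => j; rewrite {1}/pseries_diffs expm_coeff_diffs mulr_sumr.
    by apply: eq_bigr => l _; rewrite mulrCA.
  have L : (B *m \matrix_(a, b)
      pseries (pseries_diffs (expm_coeff B a b)) (`|t| + 1) N) @[N --> \oo]
      --> B *m (B *m expm ((`|t| + 1) *: B)).
    apply: (cvg_comp (fun N => \matrix_(a, b)
      pseries (pseries_diffs (expm_coeff B a b)) (`|t| + 1) N) (mulmx B)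
      (G := nbhs (B *m expm ((`|t| + 1) *: B)))).
      apply/cvg_mxP => a b.
      under eq_fun do rewrite mxE.
      exact: expm_coeff_diffs_cvg.
    exact: (@linear_mx_continuous K m m _ (mulmx B)).
  move/cvg_mxP : L => /(_ i k) L; apply/cvg_ex; eexists; apply: cvg_trans L.
  apply: near_eq_cvg; apply: nearW => N.
  rewrite mxE /pseries /series/=.
  under [RHS]eq_bigr do rewrite mulr_suml.
  rewrite exchange_big/=; apply: eq_bigr => l _.
  by rewrite mxE mulr_sumr; apply: eq_bigr => j _; rewrite mulrA.
- by rewrite [ltRHS]ger0_norm ?addr_ge0// ltrDl.
Qed.

End MatrixExponential.

(** * Linear differential equations with constant coefficients *)

Section LinearODE.
Context (K : realType).

Lemma derive0_mx_cst m n (X : K -> 'M[K]_(m, n)) :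
  (forall t : K, is_derive t (1 : K) X 0) -> forall s t, X s = X t.
Proof.
move=> X0 s t; apply/matrixP => i j.
apply: (@is_derive_0_is_cst _ (fun s => X s i j)) => x.
by have := is_derive_coord i j (X0 x); rewrite mxE.
Qed.

Lemma expm_comm m (B : 'M[K]_m) t : expm (t *: B) *m B = B *m expm (t *: B).
Proof. by apply: expm_intertwine; rewrite -scalemxAl -scalemxAr. Qed.

Lemma is_derive_expmN m (B : 'M[K]_m) (t : K) :
  is_derive t (1 : K) (fun s : K => expm (s *: - B)) (- (expm (t *: - B) *m B)).
Proof.
have -> : - (expm (t *: - B) *m B) = - B *m expm (t *: - B).
  by rewrite -expm_comm mulmxN.
exact: is_derive_expm.
Qed.

Lemma expmN_mul m (B : 'M[K]_m) t :
  expm (t *: - B) *m expm (t *: B) = 1%:M.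
Proof.
have -> : 1%:M = expm (0 *: - B) *m expm (0 *: B).
  by rewrite !scale0r !expm0 mulmx1.
apply: (@derive0_mx_cst _ _ (fun s => expm (s *: - B) *m expm (s *: B))) => s.
have -> : 0 = - (expm (s *: - B) *m B) *m expm (s *: B) +
              expm (s *: - B) *m (B *m expm (s *: B)).
  by rewrite mulNmx mulmxA addNr.
apply: is_derive_mulmx; [exact: is_derive_expmN|exact: is_derive_expm].
Qed.

Lemma expm_mulN m (B : 'M[K]_m) t :
  expm (t *: B) *m expm (t *: - B) = 1%:M.
Proof. by have := expmN_mul (- B) t; rewrite opprK. Qed.

(** The integrating factor expm (- t B) makes expm (- t B) X(t) constant. *)
Lemma left_linear_ode m p (B : 'M[K]_m) (X : K -> 'M[K]_(m, p)) :
  (forall t : K, is_derive t (1 : K) X (B *m X t)) ->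
  forall t, X t = expm (t *: B) *m X 0.
Proof.
move=> Xd t.
have H : expm (t *: - B) *m X t = X 0.
  have -> : X 0 = expm (0 *: - B) *m X 0 by rewrite scale0r expm0 mul1mx.
  apply: (@derive0_mx_cst _ _ (fun s => expm (s *: - B) *m X s)) => s.
  have -> : 0 = - (expm (s *: - B) *m B) *m X s + expm (s *: - B) *m (B *m X s).
    by rewrite mulNmx mulmxA addNr.
  by apply: is_derive_mulmx => //; exact: is_derive_expmN.
by rewrite -H mulmxA expm_mulN mul1mx.
Qed.

Lemma two_sided_linear_ode m p (B : 'M[K]_m) (C : 'M[K]_p)
    (X : K -> 'M[K]_(m, p)) :
  (forall t : K, is_derive t (1 : K) X (B *m X t + X t *m C)) ->
  forall t, X t = expm (t *: B) *m X 0 *m expm (t *: C).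
Proof.
move=> Xd t.
pose Z s := (X s *m expm (s *: - C)).
have Zd s : is_derive s (1 : K) Z (B *m Z s).
  have -> : B *m Z s = (B *m X s + X s *m C) *m expm (s *: - C) +
                       X s *m - (expm (s *: - C) *m C).
    have CE : expm (s *: - C) *m C = C *m expm (s *: - C).
      by have := expm_comm (- C) s; rewrite mulmxN mulNmx => /oppr_inj.
    by rewrite /Z mulmxDl mulmxN -!mulmxA CE addrK.
  by apply: is_derive_mulmx => //; exact: is_derive_expmN.
have := left_linear_ode Zd t; rewrite /Z scale0r expm0 mulmx1 => <-.
by rewrite -mulmxA expmN_mul mulmx1.
Qed.

(** With x as an auxiliary time, x |-> expm (x s B) expm (x t B) solves the
    linear equation of the one-parameter group of (s + t) B. *)
Lemma expmD m (B : 'M[K]_m) s t :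
  expm ((s + t) *: B) = expm (s *: B) *m expm (t *: B).
Proof.
have shiftE u : is_derive u (1 : K)
   (fun x => expm (x *: (s *: B)) *m expm (x *: (t *: B)))
   ((s + t) *: B *m (expm (u *: (s *: B)) *m expm (u *: (t *: B)))).
  have -> : (s + t) *: B *m (expm (u *: (s *: B)) *m expm (u *: (t *: B))) =
     (s *: B *m expm (u *: (s *: B))) *m expm (u *: (t *: B)) +
     expm (u *: (s *: B)) *m (t *: B *m expm (u *: (t *: B))).
    rewrite scalerDl mulmxDl mulmxA; congr (_ + _).
    rewrite !mulmxA; congr (_ *m _); apply/esym/expm_intertwine.
    rewrite -!scalemxAl -!scalemxAr -?scalemxAl !scalerA; congr (_ *: _).
    ring.
  by apply: is_derive_mulmx; exact: is_derive_expm.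
have := left_linear_ode shiftE 1.
by rewrite !scale1r !scale0r !expm0 !mulmx1 => <-.
Qed.

Lemma skew_expm_orthogonal m (B : 'M[K]_m) t : B^T = - B ->
  (expm (t *: B))^T *m expm (t *: B) = 1%:M.
Proof. by move=> BT; rewrite expm_tr linearZ/= BT expmN_mul. Qed.

(** The curves t |-> C expm (t B), C ranging over all matrices, are stable
    under differentiation. *)
Lemma smooth_expm m (B : 'M[K]_m) : smooth (fun t : K => expm (t *: B)).
Proof.
pose cE (C : 'M[K]_m) := fun t : K => C *m expm (t *: B).
have cEd C (t : K) : is_derive t (1 : K) (cE C) ((C *m B) *m expm (t *: B)).
  rewrite -mulmxA; exact: (is_derive_linear_mx (mulmx C) (is_derive_expm B t)).
have cEs r C : smooth_upto r (cE C).
  have cEf D (x : K) : differentiable (cE D) x.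
    by apply/derivable1_diffP; case: (cEd D x).
  elim: r C => [|r IHr] C; split=> // v.
  have -> : 'D_v (cE C) = cE (v *: (C *m B)).
    apply/funext => x; rewrite deriveE// -[v in LHS](mulr1 v).
    rewrite -[v * 1]/(v *: (1 : K)) linearZ/= -deriveE//.
    by case: (cEd C x) => _ ->; rewrite /cE -scalemxAl.
  exact: IHr.
have -> : (fun t : K => expm (t *: B)) = cE 1%:M.
  by apply/funext => t; rewrite /cE mul1mx.
by apply/smoothP => r; exact: cEs.
Qed.

End LinearODE.

Section OperatorExponential.
Context (K : realType) (p q : nat) (P : {linear 'M[K]_(p, q) -> 'M[K]_(p, q)}).

(** Flattening matrices to row vectors turns a linear operator into right
    multiplication by a matrix, which reduces expv to expm. *)
Lemma mxvec_iter (w : 'M[K]_(p, q)) j :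
  mxvec (iter j P w) = mxvec w *m lin_mx P ^+ j.
Proof.
elim: j => [|j IHj]; first by rewrite expr0; exact: (esym (mulmx1 _)).
by rewrite iterS exprSr -mulmxE mulmxA -IHj mul_vec_lin.
Qed.

Lemma expvE t (w : 'M[K]_(p, q)) :
  expv t P w = vec_mx (mxvec w *m expm (t *: lin_mx P)).
Proof.
apply: cvg_lim; first exact: norm_hausdorff.
have vl : linear
    (fun X : 'M[K]_(p * q) => vec_mx (mxvec w *m X) : 'M[K]_(p, q)).
  by move=> a X Z; rewrite mulmxDr -scalemxAr linearP.
pose vL := HB.pack_for {linear 'M[K]_(p * q) -> 'M[K]_(p, q)}
  (fun X : 'M[K]_(p * q) => vec_mx (mxvec w *m X) : 'M[K]_(p, q))
  (GRing.isLinear.Build _ _ _ _ _ vl).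
have := @cvg_linear_mx K _ _ _ _ vL _ _ (@expm_cvg_scale K _ (lin_mx P) t).
rewrite (_ : (fun N => vL _) =
  series (fun j => (t ^+ j / j`!%:R) *: iter j P w)) //.
apply/funext => N; rewrite /series linear_sum; apply: eq_bigr => j _.
rewrite linearZ/= exprmxZ -scalemxAr -mxvec_iter linearZ/= mxvecK scalerA.
by rewrite mulrC.
Qed.

Lemma expv0 (w : 'M[K]_(p, q)) : expv 0 P w = w.
Proof. by rewrite expvE scale0r expm0 mulmx1 mxvecK. Qed.

Lemma is_derive_expv (w : 'M[K]_(p, q)) (t : K) :
  is_derive t (1 : K) (fun s => expv s P w) (P (expv t P w)).
Proof.
have -> : (fun s => expv s P w) =
   (fun s => vec_mx (mxvec w *m expm (s *: lin_mx P))).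
  by apply/funext => s; rewrite expvE.
have -> : P (expv t P w) =
    vec_mx (mxvec w *m (lin_mx P *m expm (t *: lin_mx P))).
  by rewrite -expm_comm mulmxA -[mxvec w *m _]vec_mxK mul_vec_lin mxvecK -expvE.
apply: (@is_derive_linear_mx _ _ _ _ _ vec_mx).
apply: (@is_derive_linear_mx _ _ _ _ _ (mulmx (mxvec w))).
exact: is_derive_expm.
Qed.

Lemma linear_ode_expv (W : K -> 'M[K]_(p, q)) :
  (forall t : K, is_derive t (1 : K) W (P (W t))) ->
  forall t, W t = expv t P (W 0).
Proof.
move=> Wd t.
have Vd (s : K) : is_derive s (1 : K) (fun s => mxvec (W s))
    (0%:M *m mxvec (W s) + mxvec (W s) *m lin_mx P).
  rewrite mul_scalar_mx scale0r add0r mul_vec_lin.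
  exact: (@is_derive_linear_mx _ _ _ _ _ mxvec).
have := two_sided_linear_ode Vd t.
rewrite scale_scalar_mx mulr0 raddf0 expm0 mul1mx expvE => <-.
by rewrite mxvecK.
Qed.

Lemma smooth_expv (w : 'M[K]_(p, q)) : smooth (fun t : K => expv t P w).
Proof.
have -> : (fun s => expv s P w) =
   (fun s => vec_mx (mxvec w *m expm (s *: lin_mx P))).
  by apply/funext => s; rewrite expvE.
apply: (@smooth_linear_comp K _ _ _ vec_mx).
  exact: linear_mx_continuous.
by apply: smooth_mulmx; [exact: smooth_cst|exact: smooth_expm].
Qed.

End OperatorExponential.

(** * Normal forms of matrix expressions *)

Section MatrixNormalForm.
Context (K : realType).

Lemma trmxD m n (A B : 'M[K]_(m, n)) : (A + B)^T = A^T + B^T.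
Proof. exact: linearD. Qed.
Lemma trmxN m n (A : 'M[K]_(m, n)) : (- A)^T = - A^T.
Proof. exact: linearN. Qed.
Lemma trmxZ m n a (A : 'M[K]_(m, n)) : (a *: A)^T = a *: A^T.
Proof. exact: linearZ. Qed.

Lemma mxtraceN n (A : 'M[K]_n) : \tr (- A) = - \tr A.
Proof. exact: raddfN. Qed.

Lemma scalemxlA m n p (a : K) (A : 'M[K]_(m, n)) (B : 'M[K]_(n, p)) :
  (a *: A) *m B = a *: (A *m B).
Proof. by rewrite scalemxAl. Qed.
Lemma scalemxrA m n p (a : K) (A : 'M[K]_(m, n)) (B : 'M[K]_(n, p)) :
  A *m (a *: B) = a *: (A *m B).
Proof. by rewrite scalemxAr. Qed.

Lemma mulmx_trK m n p (Y : 'M[K]_(m, n)) (B : 'M[K]_(p, n)) :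
  Y^T *m Y = 1%:M -> B *m Y^T *m Y = B.
Proof. by move=> YY; rewrite -mulmxA YY mulmx1. Qed.

(** In a monomial associated to the left a product A B is hidden behind the
    factors that precede it; this lets an equation A B = C act there. *)
Lemma mulmx_subst m n p q (A : 'M[K]_(m, n)) (B : 'M[K]_(n, p)) C
    (D : 'M[K]_(q, m)) : A *m B = C -> D *m A *m B = D *m C.
Proof. by move=> <-; rewrite mulmxA. Qed.

Lemma mxtrace_sym_skew m (S A : 'M[K]_m) :
  S^T = S -> A^T = - A -> \tr (S *m A) = 0.
Proof.
move=> SS AA; have : \tr (S *m A) = - \tr (S *m A).
  by rewrite -{1}mxtrace_tr trmx_mul SS AA mulNmx mxtraceN/= mxtrace_mulC.
by move=> H; lra.
Qed.

End MatrixNormalForm.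

(** Rewrites an expression as a linear combination of monomials associated to
    the left. *)
Definition mx_expand (K : realType) :=
  (@trmxD K, @trmxN K, @trmxZ K, @trmx_mul K,
  @trmxK K, @mulmxDl K, @mulmxDr K, @mulmxN K, @mulNmx K,
  @mulmx1 K, @mul1mx K, @mulmx0 K, @mul0mx K, @scalemxlA K,
  @scalemxrA K, @scalerDr K, @scalerN K, @scalerA K, @mulmxA K).

(** Proves an equality between linear combinations of monomials: once the
    monomials are made opaque, it is a commutative identity in each entry. *)
Ltac mx_close :=
  repeat match goal with
  | |- context [?A *m ?B] => let M := fresh "M" in set M := A *m B; clearbody M
  end;
  repeat match goal with
  | |- context [trmx ?A] => let M := fresh "M" in set M := trmx A; clearbody M
  end;
  let i := fresh in let j := fresh in
  apply/matrixP => i j; rewrite !mxE; by field.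

(** * A connection on the Stiefel manifold *)

Section StiefelGeometry.
Context (K : realType) (n d : nat) (alpha : K).
Implicit Types x y u v w : 'M[K]_(n, d).

(** The correction to the ambient derivative that yields the Levi-Civita
    connection, as a bilinear map on all matrices.  The first summand restores
    tangency, the second one compensates the variation of the metric. *)
Definition stiefel_christoffel x u w : 'M[K]_(n, d) :=
  2^-1 *: (x *m (u^T *m w + w^T *m u)) +
  (1 - alpha) *: ((u *m w^T + w *m u^T) *m x -
                  x *m x^T *m (u *m w^T + w *m u^T) *m x).

(** The Euclidean orthogonal projection onto the tangent space at x, for x on
    the manifold.  Being polynomial in x, it extends any tangent vector to a
    vector field. *)
Definition stiefel_proj x u : 'M[K]_(n, d) :=
  u - 2^-1 *: (x *m (x^T *m u + u^T *m x)).

Lemma stiefel_metricE x u w :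
  stiefel_metric alpha x u w =
  \tr (u^T *m w) + (alpha - 1) * \tr (u^T *m x *m (x^T *m w)).
Proof.
rewrite /stiefel_metric /stiefel_qform !mx_expand !mxtraceD.
have -> : \tr (w^T *m u) = \tr (u^T *m w).
  by rewrite -mxtrace_tr trmx_mul trmxK.
have -> : \tr (w^T *m x *m x^T *m u) = \tr (u^T *m x *m x^T *m w).
  by rewrite -mxtrace_tr !mx_expand.
by field.
Qed.

Lemma stiefel_tangentP x u :
  stiefel_tangent x u -> x^T *m u = - (u^T *m x).
Proof. by move/eqP; rewrite addr_eq0 => /eqP. Qed.

Lemma stiefel_tangentE x u :
  stiefel_tangent x u = ((x^T *m u)^T = - (x^T *m u)).
Proof.
rewrite /stiefel_tangent/= trmx_mul trmxK; apply/propext.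
by split=> [/eqP|->]; [rewrite addrC addr_eq0 => /eqP|exact: addrN].
Qed.

Lemma stiefel_tangentD x u w : stiefel_tangent x u -> stiefel_tangent x w ->
  stiefel_tangent x (u + w).
Proof. by rewrite !stiefel_tangentE mulmxDr trmxD => -> ->; rewrite opprD. Qed.

Lemma stiefel_tangentZ x a u :
  stiefel_tangent x u -> stiefel_tangent x (a *: u).
Proof. by rewrite !stiefel_tangentE scalemxrA trmxZ => ->; rewrite scalerN. Qed.

Lemma stiefel_proj_tangent x u :
  stiefel x -> stiefel_tangent x (stiefel_proj x u).
Proof.
rewrite /stiefel/= => xx; rewrite /stiefel_tangent/= /stiefel_proj.
rewrite !mx_expand xx !(mulmx_trK _ xx) !mul1mx.
mx_close.
Qed.

Lemma stiefel_proj_id x u : stiefel_tangent x u -> stiefel_proj x u = u.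
Proof. by move=> xu; rewrite /stiefel_proj xu mulmx0 scaler0 subr0. Qed.

Lemma stiefel_christoffelC x u w :
  stiefel_christoffel x u w = stiefel_christoffel x w u.
Proof.
by rewrite /stiefel_christoffel [u^T *m w + _]addrC [u *m w^T + _]addrC.
Qed.

Lemma stiefel_christoffel_linear x u : linear (stiefel_christoffel x u).
Proof.
move=> a w z; rewrite /stiefel_christoffel !mx_expand.
mx_close.
Qed.

End StiefelGeometry.

Section StiefelLeviCivita.
Context (K : realType) (n d : nat) (alpha : K).
Implicit Types x y u v w : 'M[K]_(n, d).

(** The orthogonal group is transitive on the manifold, already at the level of
    velocities: some skew matrix Om satisfies Om x = v, and t |-> expm (t Om) x
    is the curve. *)
Lemma stiefel_tangent_curve x v : stiefel x -> stiefel_tangent x v ->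
  exists c : K -> 'M[K]_(n, d),
    [/\ forall t, stiefel (c t), c 0 = x & is_derive (0 : K) (1 : K) c v].
Proof.
move=> xx xv; have xvE := stiefel_tangentP xv; rewrite /stiefel/= in xx.
pose Om := v *m x^T - x *m v^T + x *m v^T *m x *m x^T.
have OmT : Om^T = - Om.
  rewrite /Om !mx_expand (mulmx_subst _ xvE) mulmxN mulNmx !mulmxA.
  mx_close.
have Omx : Om *m x = v.
  rewrite /Om !mx_expand !(mulmx_trK _ xx).
  by rewrite subrK.
exists (fun t => expm (t *: Om) *m x); split.
- move=> t; rewrite /stiefel/= trmx_mul mulmxA -(mulmxA x^T).
  by rewrite skew_expm_orthogonal// mulmx1.
- by rewrite scale0r expm0 mul1mx.
- have -> : v = (Om *m expm (0 *: Om)) *m x by rewrite scale0r expm0 mulmx1.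
  exact: (is_derive_linear_mx (mulmxr x) (is_derive_expm Om 0)).
Qed.

Let M := @stiefel K n d.
Let T := @stiefel_tangent K n d.

(** The ambient derivative of a vector field need not be tangent.  Its defect
    is obtained by differentiating x^T Z + Z^T x = 0, an identity that holds on
    the manifold only, so a curve in the manifold with velocity v is needed. *)
Lemma derive_vector_field (Z : 'M[K]_(n, d) -> 'M[K]_(n, d)) x v :
  vector_field M T Z -> stiefel x -> stiefel_tangent x v ->
  v^T *m Z x + x^T *m 'D_v Z x + (('D_v Z x)^T *m x + (Z x)^T *m v) = 0.
Proof.
move=> [Zs ZT] xx xv; have [c [cM c0 cd]] := stiefel_tangent_curve xx xv.
have Zcd : is_derive (0 : K) (1 : K) (Z \o c) ('D_v Z x).
  rewrite -c0; apply: is_derive_comp_curve => //.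
  exact: smooth_differentiable.
have cTd := is_derive_linear_mx (@trmx K n d) cd.
have ZcTd := is_derive_linear_mx (@trmx K n d) Zcd.
have := is_deriveD (is_derive_mulmx cTd Zcd) (is_derive_mulmx ZcTd cd).
rewrite /= c0 => -[_ <-].
rewrite (_ : _ + _ = fun _ => 0); first by rewrite derive_cst.
by apply/funext => t; exact: (ZT _ (cM t)).
Qed.

Definition stiefel_nabla x v (Z : 'M[K]_(n, d) -> 'M[K]_(n, d)) :=
  'D_v Z x + stiefel_christoffel alpha x v (Z x).

(** With (u, w, s) = (v, Z x, derivative of Z along v), or (c', V, V') along a
    curve, the hypothesis is the differentiated tangency equation; x^T times
    the correction has symmetric part (u^T w + w^T u) / 2, which cancels the
    defect. *)
Lemma christoffel_tangent x u w s : stiefel x ->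
  u^T *m w + x^T *m s + (s^T *m x + w^T *m u) = 0 ->
  stiefel_tangent x (s + stiefel_christoffel alpha x u w).
Proof.
rewrite /stiefel/= => xx H; rewrite /stiefel_tangent/= -[RHS]H.
rewrite /stiefel_christoffel !mx_expand xx !mul1mx !(mulmx_trK _ xx).
mx_close.
Qed.

Lemma stiefel_nabla_tangent (Z : 'M[K]_(n, d) -> 'M[K]_(n, d)) x v :
  vector_field M T Z -> stiefel x -> stiefel_tangent x v ->
  stiefel_tangent x (stiefel_nabla x v Z).
Proof.
move=> ZF xx xv; apply: christoffel_tangent => //.
exact: derive_vector_field.
Qed.

(** The summand x S of the correction, S symmetric, contributes nothing, since
    x^T w is skew. *)
Lemma metric_christoffel x u v w : stiefel x ->
  stiefel_tangent x w ->
  stiefel_metric alpha x (stiefel_christoffel alpha x v u) w =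
  (1 - alpha) * (\tr (x^T *m v *m (u^T *m w)) + \tr (x^T *m u *m (v^T *m w))
   - (\tr (x^T *m v *m (u^T *m x) *m (x^T *m w))
      + \tr (x^T *m u *m (v^T *m x) *m (x^T *m w)))).
Proof.
rewrite /stiefel/= => xx xw; rewrite stiefel_metricE /stiefel_christoffel.
pose S := v^T *m u + u^T *m v.
have S0 : \tr (S *m (x^T *m w)) = 0.
  apply: mxtrace_sym_skew; first by rewrite /S !mx_expand addrC.
  by rewrite -stiefel_tangentE.
move/eqP: S0; rewrite /S !mx_expand !mxtraceD addr_eq0 => /eqP S0.
rewrite !(mulmx_trK _ xx) ?(mxtraceD, mxtraceZ, mxtraceN) /=.
rewrite ?(mxtraceD, mxtraceZ) S0.
ring.
Qed.

Lemma stiefel_metricC x u w :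
  stiefel_metric alpha x u w = stiefel_metric alpha x w u.
Proof.
rewrite !stiefel_metricE -mxtrace_tr; congr (_ + _ * _).
  by rewrite !mx_expand.
by rewrite -mxtrace_tr !mx_expand.
Qed.

(** The right-hand side is the derivative along v of the coefficients of the
    metric.  Transposing a trace changes the sign of each of the skew matrices
    U = x^T u, V = x^T v, W = x^T w in it, which makes the cubic terms in
    U, V, W and the terms in V cancel in pairs. *)
Lemma christoffel_compatible x u v w : stiefel x ->
  stiefel_tangent x u -> stiefel_tangent x v -> stiefel_tangent x w ->
  stiefel_metric alpha x (stiefel_christoffel alpha x v u) w +
  stiefel_metric alpha x u (stiefel_christoffel alpha x v w) =
  (alpha - 1) * (\tr (u^T *m v *m (x^T *m w)) + \tr (u^T *m x *m (v^T *m w))).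
Proof.
move=> xx xu xv xw; rewrite [stiefel_metric _ x u _]stiefel_metricC.
rewrite !metric_christoffel//.
move: (stiefel_tangentP xu) (stiefel_tangentP xv) (stiefel_tangentP xw).
have trE p q (A : 'M[K]_(p, q)) B : \tr (A *m B) = \tr (A^T *m B^T).
  by rewrite -mxtrace_tr trmx_mul mxtrace_mulC.
set V := x^T *m v; set U := x^T *m u; set W := x^T *m w.
move=> UE VE WE.
have UT : U^T = - U by rewrite -stiefel_tangentE.
have VT : V^T = - V by rewrite -stiefel_tangentE.
have WT : W^T = - W by rewrite -stiefel_tangentE.
have -> : u^T *m x = - U by rewrite UE opprK.
have -> : v^T *m x = - V by rewrite VE opprK.
have -> : w^T *m x = - W by rewrite WE opprK.
clearbody U V W.
have e1 : \tr (V *m (w^T *m u)) = - \tr (V *m (u^T *m w)).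
  by rewrite trE VT mulNmx trmx_mul trmxK mxtraceN.
have e2 : \tr (u^T *m v *m W) = - \tr (W *m (v^T *m u)).
  by rewrite [LHS]trE WT mulmxN trmx_mul trmxK mxtraceN/= [in LHS]mxtrace_mulC.
have e3 : \tr (U *m V *m W) = - \tr (V *m U *m W).
  rewrite -[LHS]mxtrace_tr !trmx_mul UT VT WT !(mulNmx, mulmxN).
  rewrite !mxtraceN/= !opprK.
  by rewrite mxtrace_mulC.
have e4 : \tr (W *m V *m U) = - \tr (V *m W *m U).
  rewrite -[LHS]mxtrace_tr !trmx_mul UT VT WT !(mulNmx, mulmxN).
  rewrite !mxtraceN/= !opprK.
  by rewrite mxtrace_mulC.
rewrite e1 e2 !(mulNmx, mulmxN) !mxtraceN/= e3 e4.
ring.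
Qed.

Lemma stiefel_metricDl x u v w :
  stiefel_metric alpha x (u + v) w =
  stiefel_metric alpha x u w + stiefel_metric alpha x v w.
Proof. by rewrite !stiefel_metricE !mx_expand !mxtraceD; ring. Qed.

Lemma stiefel_metricDr x u v w :
  stiefel_metric alpha x u (v + w) =
  stiefel_metric alpha x u v + stiefel_metric alpha x u w.
Proof. by rewrite !(stiefel_metricC x u) stiefel_metricDl. Qed.

Lemma stiefel_metricBl x u v w :
  stiefel_metric alpha x (u - v) w =
  stiefel_metric alpha x u w - stiefel_metric alpha x v w.
Proof. by rewrite !stiefel_metricE !mx_expand !mxtraceD !mxtraceN /=; ring. Qed.

Lemma stiefel_metricBr x u v w :
  stiefel_metric alpha x u (v - w) =
  stiefel_metric alpha x u v - stiefel_metric alpha x u w.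
Proof. by rewrite !(stiefel_metricC x u) stiefel_metricBl. Qed.

(** The test vector u + b x x^T u is tangent, and b can be chosen so that the
    pairing reduces to the Euclidean square norm of u; this solves
    b alpha = 1 - alpha, hence needs alpha to be nonzero. *)
Lemma stiefel_metric_nondegenerate x u : alpha != 0 -> stiefel x ->
  stiefel_tangent x u ->
  (forall w, stiefel_tangent x w -> stiefel_metric alpha x u w = 0) -> u = 0.
Proof.
move=> a0 xx xu H; rewrite /stiefel/= in xx.
pose b := (1 - alpha) / alpha.
have wT : stiefel_tangent x (u + b *: (x *m (x^T *m u))).
  move: (stiefel_tangentP xu) => xuE.
  rewrite /stiefel_tangent/= !mx_expand xx !mul1mx !(mulmx_trK _ xx) xuE.
  mx_close.
have := H _ wT.
rewrite stiefel_metricE !mx_expand ?(mulmx_trK _ xx) ?(mxtraceD, mxtraceZ).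
set p := \tr (u^T *m x *m x^T *m u); set q := \tr (u^T *m u) => pq.
have q0 : q = 0 by rewrite -pq /b; field.
apply/matrixP => i j; rewrite mxE.
have := q0; rewrite /q /mxtrace.
under eq_bigr do rewrite mxE.
rewrite exchange_big/= => /psumr_eq0P => qi.
have {}qi : forall k, \sum_l u^T l k * u k l = 0.
  move=> k; apply: qi => // k' _; apply: sumr_ge0 => l _.
  by rewrite mxE -expr2 sqr_ge0.
have := qi i => /psumr_eq0P qij.
have : u^T j i * u i j = 0.
  by apply: qij => // l _; rewrite mxE -expr2 sqr_ge0.
by rewrite mxE => /eqP; rewrite mulf_eq0 orbb => /eqP.
Qed.

End StiefelLeviCivita.

(** * Uniqueness of the Levi-Civita connection *)

Section LeviCivitaUnique.
Context (K : realType) (n d : nat) (alpha : K).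
Implicit Types x y u v w : 'M[K]_(n, d).
Let M := @stiefel K n d.
Let T := @stiefel_tangent K n d.

Lemma derive_metric (X Z : 'M[K]_(n, d) -> 'M[K]_(n, d)) x v :
  smooth X -> smooth Z ->
  'D_v (fun y => stiefel_metric alpha y (X y) (Z y)) x =
  stiefel_metric alpha x ('D_v X x) (Z x) +
  stiefel_metric alpha x (X x) ('D_v Z x) +
  (alpha - 1) * (\tr ((X x)^T *m v *m (x^T *m Z x)) +
                 \tr ((X x)^T *m x *m (v^T *m Z x))).
Proof.
move=> Xs Zs.
have Xd : is_derive x v X ('D_v X x).
  by apply/derivableP/diff_derivable; exact: smooth_differentiable.
have Zd : is_derive x v Z ('D_v Z x).
  by apply/derivableP/diff_derivable; exact: smooth_differentiable.
have idd : is_derive x v (@id 'M[K]_(n, d)) v by exact: is_derive_id.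
have XTd := is_derive_trmx Xd; have idTd := is_derive_trmx idd.
have D1 := is_derive_mxtrace (is_derive_mulmx XTd Zd).
have D2 := is_derive_mxtrace
  (is_derive_mulmx (is_derive_mulmx XTd idd) (is_derive_mulmx idTd Zd)).
have D3 := is_deriveD D1 (is_deriveZ (alpha - 1) D2).
rewrite (_ : (fun y => _) = (fun y => \tr ((X y)^T *m Z y)) +
  (alpha - 1) \*: (fun y => \tr ((X y)^T *m y *m (y^T *m Z y)))); last first.
  by apply/funext => y; rewrite stiefel_metricE.
rewrite (@derive_val _ _ _ _ _ _ _ D3) !stiefel_metricE /GRing.scale/=.
rewrite !mulmxDl !mulmxDr !mxtraceD.
ring.
Qed.

Lemma stiefel_nabla_compatible (X Z : 'M[K]_(n, d) -> 'M[K]_(n, d)) x v :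
  vector_field M T X -> vector_field M T Z -> M x -> T x v ->
  'D_v (fun y => stiefel_metric alpha y (X y) (Z y)) x =
  stiefel_metric alpha x (stiefel_nabla alpha x v X) (Z x) +
  stiefel_metric alpha x (X x) (stiefel_nabla alpha x v Z).
Proof.
move=> [Xs XT] [Zs ZT] xM xv; rewrite derive_metric// /stiefel_nabla.
rewrite stiefel_metricDl stiefel_metricDr.
rewrite -(christoffel_compatible _ xM (XT _ xM) xv (ZT _ xM)).
ring.
Qed.

Lemma smooth_stiefel_proj (V : normedModType K) (y u : V -> 'M[K]_(n, d)) :
  smooth y -> smooth u -> smooth (fun s => stiefel_proj (y s) (u s)).
Proof.
move=> ys us; apply: smoothD => //; apply/smoothN/smoothZ/smooth_mulmx => //.
apply: smoothD; apply: smooth_mulmx => //; exact: smooth_trmx.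
Qed.

Lemma stiefel_proj_field u : vector_field M T (fun y => stiefel_proj y u).
Proof.
split=> [|x xM]; last exact: stiefel_proj_tangent.
by apply: smooth_stiefel_proj; [exact: smooth_id|exact: smooth_cst].
Qed.

(** The difference of two torsion-free metric connections is symmetric in its
    two fields and, paired with a third one, skew in the last two.  Such a
    form equals its own opposite after three exchanges of each kind. *)
Lemma levi_civita_stiefelE nabla : alpha != 0 ->
  levi_civita M T (@stiefel_metric K n d alpha) nabla ->
  forall x v Z, vector_field M T Z -> M x -> T x v ->
  nabla x v Z = stiefel_nabla alpha x v Z.
Proof.
move=> a0 [nablaA nablaT nablaM] x v Z ZF xM xv.
pose S X W := nabla x (X x) W - stiefel_nabla alpha x (X x) W.
have ST X W : vector_field M T X -> vector_field M T W -> T x (S X W).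
  move=> XF WF; have XT := XF.2 x xM.
  apply: stiefel_tangentD; first exact: (connection_tangent nablaA WF xM XT).
  rewrite -scaleN1r; apply: stiefel_tangentZ.
  exact: (stiefel_nabla_tangent alpha WF xM XT).
have Ssym X W : vector_field M T X -> vector_field M T W -> S X W = S W X.
  move=> XF WF; have := nablaT X W x XF WF xM.
  rewrite /S /stiefel_nabla stiefel_christoffelC.
  have cancel (a b e h : 'M[K]_(n, d)) : a - b + e - (a + h) = e - (b + h).
    by mx_close.
  by move=> /eqP; rewrite subr_eq => /eqP ->; exact: cancel.
have Sskew X W U :
    vector_field M T X -> vector_field M T W -> vector_field M T U ->
  stiefel_metric alpha x (S X W) (U x) = - stiefel_metric alpha x (S X U) (W x).
  move=> XF WF UF; have XT := XF.2 x xM.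
  have := nablaM W U x (X x) WF UF xM XT.
  rewrite (stiefel_nabla_compatible WF UF xM XT) => H.
  have e1 : stiefel_metric alpha x (S X W) (U x) =
      stiefel_metric alpha x (nabla x (X x) W) (U x) -
      stiefel_metric alpha x (stiefel_nabla alpha x (X x) W) (U x).
    exact: stiefel_metricBl.
  have e2 : stiefel_metric alpha x (S X U) (W x) =
      stiefel_metric alpha x (W x) (nabla x (X x) U) -
      stiefel_metric alpha x (W x) (stiefel_nabla alpha x (X x) U).
    exact: etrans (stiefel_metricC _ _ _ _) (stiefel_metricBr _ _ _ _ _).
  apply: (etrans e1); apply: esym; apply: (etrans (congr1 -%R e2)).
  apply/eqP; rewrite opprB subr_eq addrAC eq_sym subr_eq.
  by rewrite -H addrC.
(* torsion involves X as a field: v has to be extended *)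
pose X y := stiefel_proj y v.
have XF : vector_field M T X by exact: stiefel_proj_field.
have Xx : X x = v by exact: stiefel_proj_id.
have SE : S X Z = nabla x v Z - stiefel_nabla alpha x v Z by rewrite /S Xx.
apply/eqP; rewrite -subr_eq0 -SE; apply/eqP.
apply: (stiefel_metric_nondegenerate a0 xM (ST _ _ XF ZF)) => w xw.
pose W y := stiefel_proj y w.
have WF : vector_field M T W by exact: stiefel_proj_field.
have <- : W x = w by exact: stiefel_proj_id.
clearbody S W.
have e1 := Sskew _ _ _ XF ZF WF; have e2 := Sskew _ _ _ WF XF ZF.
have e3 := Sskew _ _ _ ZF WF XF.
rewrite -(Ssym _ _ XF WF) in e2; rewrite (Ssym _ _ ZF WF) in e3.
rewrite -(Ssym _ _ XF ZF) in e3.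
move/eqP: e1; rewrite e2 e3 !opprK -addr_eq0 -mulr2n mulrn_eq0.
by move=> /eqP.
Qed.

End LeviCivitaUnique.

(** * Covariant derivative along a curve *)

Section CovariantDerivative.
Context (K : realType) (n d : nat) (alpha : K).
Let M := @stiefel K n d.
Let T := @stiefel_tangent K n d.
Let g := @stiefel_metric K n d alpha.

Lemma smooth_christoffel (V : normedModType K) (x u w : V -> 'M[K]_(n, d)) :
  smooth x -> smooth u -> smooth w ->
  smooth (fun s => stiefel_christoffel alpha (x s) (u s) (w s)).
Proof.
move=> xs us ws.
have trs f : smooth f -> smooth (fun s => (f s)^T : 'M[K]_(d, n)).
  exact: smooth_trmx.
have Ns : smooth (fun s => u s *m (w s)^T + w s *m (u s)^T).
  by apply: smoothD; apply: smooth_mulmx => //; exact: trs.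
apply: smoothD; apply: smoothZ.
  apply: smooth_mulmx => //.
  apply: smoothD; apply: smooth_mulmx => //; exact: trs.
apply: smoothD; first exact: smooth_mulmx.
apply: smoothN; apply: smooth_mulmx => //; apply: smooth_mulmx => //.
by apply: smooth_mulmx => //; exact: trs.
Qed.

Lemma derive1_field_along (c V : K -> 'M[K]_(n, d)) (t : K) :
  smooth c -> field_along T c V ->
  (derive1 c t)^T *m V t + (c t)^T *m derive1 V t +
  ((derive1 V t)^T *m c t + (V t)^T *m derive1 c t) = 0.
Proof.
move=> cs [Vs VT].
have cd := smooth_is_derive1 t cs; have Vd := smooth_is_derive1 t Vs.
have := is_deriveD (is_derive_mulmx (is_derive_trmx cd) Vd)
                   (is_derive_mulmx (is_derive_trmx Vd) cd).
move=> [_ <-]; rewrite (_ : _ + _ = fun _ => 0); first by rewrite derive_cst.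
by apply/funext => s; exact: VT.
Qed.

Lemma velocity_tangent (c : K -> 'M[K]_(n, d)) (t : K) :
  curve_in M c -> T (c t) (derive1 c t).
Proof.
move=> [cs cM]; have cd := smooth_is_derive1 t cs.
have := is_derive_mulmx (is_derive_trmx cd) cd.
rewrite (_ : (fun y => _) = (fun _ => 1%:M)); last first.
  by apply/funext => s; exact: cM.
by move=> [_]; rewrite derive_cst addrC => /esym.
Qed.

Definition stiefel_covariant (c V : K -> 'M[K]_(n, d)) (t : K) :=
  derive1 V t + stiefel_christoffel alpha (c t) (derive1 c t) (V t).

Lemma field_alongD (c V W : K -> 'M[K]_(n, d)) :
  field_along T c V -> field_along T c W ->
  field_along T c (fun s => V s + W s).
Proof.
move=> [Vs VT] [Ws WT]; split=> [|t]; first exact: smoothD.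
exact: (stiefel_tangentD (VT t) (WT t)).
Qed.

Lemma field_alongZ (c V : K -> 'M[K]_(n, d)) (f : K -> K) :
  smooth f -> field_along T c V -> field_along T c (fun s => f s *: V s).
Proof.
move=> fs [Vs VT]; split=> [|t]; first exact: smooth_scale.
exact: (stiefel_tangentZ _ (VT t)).
Qed.

Lemma christoffelDr x u (w z : 'M[K]_(n, d)) :
  stiefel_christoffel alpha x u (w + z) =
  stiefel_christoffel alpha x u w + stiefel_christoffel alpha x u z.
Proof.
by have := stiefel_christoffel_linear alpha x u 1 w z; rewrite !scale1r.
Qed.

Lemma christoffelZr x u (a : K) (w : 'M[K]_(n, d)) :
  stiefel_christoffel alpha x u (a *: w) =
  a *: stiefel_christoffel alpha x u w.
Proof.
have H0 : stiefel_christoffel alpha x u 0 = 0.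
  have := christoffelDr x u 0 0; rewrite addr0 => /eqP.
  by rewrite -subr_eq0 opprD addrA subrr sub0r oppr_eq0 => /eqP.
by have := stiefel_christoffel_linear alpha x u a w 0; rewrite H0 !addr0.
Qed.

Variable nabla : 'M[K]_(n, d) -> 'M[K]_(n, d) ->
                 ('M[K]_(n, d) -> 'M[K]_(n, d)) -> 'M[K]_(n, d).
Hypothesis alpha0 : alpha != 0.
Hypothesis nablaLC : levi_civita M T g nabla.

Lemma stiefel_covariant_derivative c :
  curve_in M c -> covariant_derivative_along M T nabla c (stiefel_covariant c).
Proof.
move=> cC; have [cs cM] := cC; split.
- move=> V VF; split=> [|t].
    apply: smoothD; first exact: (smooth_derive1 VF.1).
    by apply: smooth_christoffel => //; [exact: smooth_derive1|exact: VF.1].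
  by apply: christoffel_tangent; [exact: cM|exact: derive1_field_along].
- move=> V W t [Vs VT] [Ws WT]; rewrite /stiefel_covariant christoffelDr.
  have VWd := is_deriveD (smooth_is_derive1 t Vs) (smooth_is_derive1 t Ws).
  by rewrite (is_derive1E VWd) addrACA.
- move=> f V t fs [Vs VT]; rewrite /stiefel_covariant christoffelZr.
  suff -> : derive1 (fun s => f s *: V s) t =
      derive1 f t *: V t + f t *: derive1 V t.
    by rewrite -addrA -scalerDr.
  apply: is_derive1E; rewrite -!mul_scalar_mx.
  rewrite (_ : (fun y => _) = (fun y => (f y)%:M *m V y)); last first.
    by apply/funext => s; rewrite mul_scalar_mx.
  apply: is_derive_mulmx; last exact: smooth_is_derive1.
  apply: is_derive_mx => i j; rewrite mxE -mulr_natr.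
  rewrite (_ : (fun y => _) = (fun y => f y * (i == j)%:R)); last first.
    by apply/funext => s; rewrite mxE mulr_natr.
  have := is_deriveM (smooth_is_derive1 t fs)
                     (is_derive_cst ((i == j)%:R : K) t (1 : K)).
  by rewrite scaler0 add0r [_ *: _]mulrC.
- move=> Z t ZF.
  have vT := velocity_tangent t cC.
  rewrite (levi_civita_stiefelE alpha0 nablaLC ZF (cM t) vT).
  have Zd := smooth_differentiable (c t) ZF.1.
  have ZcE := is_derive_comp_curve (smooth_is_derive1 t cs) Zd.
  by rewrite /stiefel_covariant (is_derive1E ZcE).
Qed.

(** A tangent vector is its own projection, and the projection is linear: the
    projected coordinate directions span all tangent spaces, with the entries
    of V as coefficients. *)
Lemma field_along_generated (c V : K -> 'M[K]_(n, d)) : field_along T c V ->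
  V = fun s => \sum_(p : 'I_n * 'I_d)
        V s p.1 p.2 *: stiefel_proj (c s) (delta_mx p.1 p.2).
Proof.
move=> [_ VT]; apply/funext => s; rewrite -[LHS](stiefel_proj_id (VT s)).
have projE (x u : 'M[K]_(n, d)) : stiefel_proj x u =
    \sum_(p : 'I_n * 'I_d) u p.1 p.2 *: stiefel_proj x (delta_mx p.1 p.2).
  have pl : linear (fun u : 'M[K]_(n, d) => stiefel_proj x u : 'M[K]_(n, d)).
    by move=> a w z; rewrite /stiefel_proj !mx_expand; mx_close.
  pose pL := HB.pack_for {linear 'M[K]_(n, d) -> 'M[K]_(n, d)}
    (fun u : 'M[K]_(n, d) => stiefel_proj x u : 'M[K]_(n, d))
    (GRing.isLinear.Build _ _ _ _ _ pl).
  rewrite -[LHS]/(pL u) {1}(matrix_sum_delta u) pair_bigA linear_sum.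
  by apply: eq_bigr => p _; rewrite linearZ.
exact: projE.
Qed.

(** The rules of a covariant derivative along c determine it on combinations of
    restricted vector fields, hence on every field along c: the right-hand side
    does not mention D. *)
Lemma covariant_derivative_expand (c : K -> 'M[K]_(n, d)) D V t :
  curve_in M c -> covariant_derivative_along M T nabla c D ->
  field_along T c V ->
  D V t = \sum_(p : 'I_n * 'I_d)
    (derive1 (fun s => V s p.1 p.2) t *: stiefel_proj (c t) (delta_mx p.1 p.2) +
     V t p.1 p.2 *: nabla (c t) (derive1 c t)
       (fun y => stiefel_proj y (delta_mx p.1 p.2))).
Proof.
move=> cC DC VF.
pose F (p : 'I_n * 'I_d) s :=
  V s p.1 p.2 *: stiefel_proj (c s) (delta_mx p.1 p.2).
pose Z (p : 'I_n * 'I_d) y := stiefel_proj y (delta_mx p.1 p.2 : 'M[K]_(n, d)).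
have fs (p : 'I_n * 'I_d) : smooth (fun s => V s p.1 p.2).
  exact: smooth_coord VF.1.
have ZF p : vector_field M T (Z p) by exact: stiefel_proj_field.
have ZcF p : field_along T c (Z p \o c).
  split=> [|s]; last exact: stiefel_proj_tangent (cC.2 s).
  by apply: smooth_stiefel_proj; [exact: cC.1|exact: smooth_cst].
have FF p : field_along T c (F p) by exact: (field_alongZ (fs p) (ZcF p)).
have zeroF : field_along T c (fun=> 0).
  rewrite (_ : (fun=> 0) = fun s => (0 : K) *: V s).
    exact: (field_alongZ (@smooth_cst K K K 0) VF).
  by apply/funext => s; rewrite scale0r.
have D0 : D (fun=> 0) t = 0.
  have := along_leibniz DC t (@smooth_cst K K K 0) VF.
  rewrite (_ : (fun s => (0 : K) *: V s) = fun=> 0); last first.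
    by apply/funext => s; rewrite scale0r.
  by rewrite (is_derive1E (is_derive_cst (0 : K) t (1 : K))) !scale0r addr0.
have sumD (r : seq ('I_n * 'I_d)) :
    field_along T c (fun s => \sum_(p <- r) F p s) /\
    D (fun s => \sum_(p <- r) F p s) t = \sum_(p <- r) D (F p) t.
  elim: r => [|p r [IHF IHD]].
    rewrite (_ : (fun s => _) = fun=> 0); first by rewrite big_nil.
    by apply/funext => s; rewrite big_nil.
  rewrite (_ : (fun s => _) = fun s => F p s + \sum_(p <- r) F p s); last first.
    by apply/funext => s; rewrite big_cons.
  split; first exact: field_alongD.
  by rewrite big_cons (along_add DC)// IHD.
rewrite {1}(field_along_generated VF) (sumD _).2; apply: eq_bigr => p _.
rewrite (along_leibniz DC t (fs p) (ZcF p)) (along_restrict DC)//.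
Qed.

Lemma parallel_alongP c V : curve_in M c ->
  parallel_along M T nabla c V <->
  field_along T c V /\ forall t, stiefel_covariant c V t = 0.
Proof.
move=> cC; have D0 := stiefel_covariant_derivative cC.
split=> [[VF [D DC DV]]|[VF DV]]; last first.
  by split=> //; exists (stiefel_covariant c).
split=> // t; rewrite -(DV t) (covariant_derivative_expand t cC DC VF).
exact: (covariant_derivative_expand t cC D0 VF).
Qed.

End CovariantDerivative.

(** * Geodesics *)

Section Geodesics.
Context (K : realType) (n d : nat) (alpha : K).
Implicit Types x v : 'M[K]_(n, d).
Let M := @stiefel K n d.
Let T := @stiefel_tangent K n d.
Let g := @stiefel_metric K n d alpha.

(** For v tangent at x, the momentum map of the left action of O(n): it is
    p x^T - x p^T, where p = v + (alpha - 1) x x^T v represents, in the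
    Euclidean inner product, the pairing with v in the metric. *)
Definition stiefel_momentum (x v : 'M[K]_(n, d)) : 'M[K]_n :=
  v *m x^T - x *m v^T + (2 * (alpha - 1)) *: (x *m (x^T *m v) *m x^T).

Lemma stiefel_momentum_skew x v : stiefel_tangent x v ->
  (stiefel_momentum x v)^T = - stiefel_momentum x v.
Proof.
move=> xv; have xvE := stiefel_tangentP xv.
rewrite /stiefel_momentum !mx_expand -[x *m x^T *m v]mulmxA xvE !mx_expand.
mx_close.
Qed.

Lemma stiefel_momentumE x v : stiefel x -> stiefel_tangent x v ->
  stiefel_momentum x v *m x + (1 - 2 * alpha) *: (x *m (x^T *m v)) = v.
Proof.
rewrite /stiefel/= => xx xv; have xvE := stiefel_tangentP xv.
rewrite /stiefel_momentum !mx_expand !(mulmx_trK _ xx).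
rewrite !(mulmx_subst _ xvE) !mx_expand.
mx_close.
Qed.

(** The left-hand side is the derivative of c^T c' when c'' is minus the
    correction term. *)
Lemma geodesic_body_velocity_rate x v : stiefel x ->
  v^T *m v - x^T *m stiefel_christoffel alpha x v v = 0.
Proof.
rewrite /stiefel/= => xx; rewrite /stiefel_christoffel !mx_expand xx !mul1mx.
mx_close.
Qed.

(** The left-hand side is the derivative of the momentum along a geodesic, with
    s the acceleration and A = c^T c' already known to be constant. *)
Lemma geodesic_momentum_rate x v (s : 'M[K]_(n, d)) A :
  stiefel x -> stiefel_tangent x v -> A = x^T *m v ->
  s = - stiefel_christoffel alpha x v v ->
  s *m x^T + v *m v^T - (v *m v^T + x *m s^T) +
    (2 * (alpha - 1)) *: ((v *m A) *m x^T + (x *m A) *m v^T) = 0.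
Proof.
rewrite /stiefel/= => xx xv AE ->.
have vx : v^T *m x = - A by rewrite AE (stiefel_tangentP xv) opprK.
have AT : A^T = - A by rewrite AE -stiefel_tangentE.
rewrite /stiefel_christoffel ?mx_expand ?(mulmx_subst _ vx).
rewrite ?(mulmx_subst _ (esym AE)) ?mx_expand.
rewrite ?(mulmx_subst _ (esym AE)) ?(mulmx_subst _ vx).
rewrite ?mx_expand ?AT ?mx_expand.
mx_close.
Qed.

(** O(n) and O(d) act by isometries. *)
Lemma christoffel_equivariant (E : 'M[K]_n) (F : 'M[K]_d) x u w :
  E^T *m E = 1%:M -> F *m F^T = 1%:M ->
  stiefel_christoffel alpha (E *m x *m F) (E *m u *m F) (E *m w *m F) =
  E *m stiefel_christoffel alpha x u w *m F.
Proof.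
move=> EE FF; rewrite /stiefel_christoffel !mx_expand.
rewrite !(mulmx_subst _ EE) !(mulmx_subst _ FF) !mulmx1.
by [].
Qed.

Variable nabla : 'M[K]_(n, d) -> 'M[K]_(n, d) ->
                 ('M[K]_(n, d) -> 'M[K]_(n, d)) -> 'M[K]_(n, d).
Hypothesis alpha0 : alpha != 0.
Hypothesis nablaLC : levi_civita M T g nabla.
Variable c : K -> 'M[K]_(n, d).
Hypothesis cG : geodesic M T nabla c.

Let v := derive1 c.
Let A := (c 0)^T *m v 0.
Let Om := stiefel_momentum (c 0) (v 0).

Let cd (t : K) : is_derive t (1 : K) c (v t).
Proof. exact: (smooth_is_derive1 t cG.1.1). Qed.

Let vd (t : K) :
  is_derive t (1 : K) v (- stiefel_christoffel alpha (c t) (v t) (v t)).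
Proof.
have [cC /(parallel_alongP alpha0 nablaLC _ cC)[VF DV]] := cG.
have := smooth_is_derive1 t VF.1; rewrite -/v.
have /eqP := DV t; rewrite /stiefel_covariant addr_eq0 => /eqP.
by rewrite -/v => ->.
Qed.

Let vT t : stiefel_tangent (c t) (v t).
Proof. exact: (velocity_tangent t cG.1). Qed.

Let cM t : stiefel (c t). Proof. exact: cG.1.2. Qed.

(** Invariance under the right action of O(d). *)
Lemma geodesic_body_velocity t : (c t)^T *m v t = A.
Proof.
suff H (s : K) : is_derive s (1 : K) (fun s => (c s)^T *m v s) 0.
  exact: (derive0_mx_cst H t 0).
rewrite -(geodesic_body_velocity_rate (v s) (cM s)) -mulmxN.
exact: is_derive_mulmx (is_derive_trmx (cd s)) (vd s).
Qed.

(** Invariance under the left action of O(n). *)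
Lemma geodesic_momentum t : stiefel_momentum (c t) (v t) = Om.
Proof.
have OmE s : stiefel_momentum (c s) (v s) =
    v s *m (c s)^T - c s *m (v s)^T +
    (2 * (alpha - 1)) *: (c s *m A *m (c s)^T).
  by rewrite /stiefel_momentum geodesic_body_velocity.
rewrite /Om !OmE.
suff H (s : K) : is_derive s (1 : K) (fun s => v s *m (c s)^T -
    c s *m (v s)^T + (2 * (alpha - 1)) *: (c s *m A *m (c s)^T)) 0.
  exact: (derive0_mx_cst H t 0).
have AE := esym (geodesic_body_velocity s).
rewrite -(geodesic_momentum_rate (cM s) (vT s) AE erefl).
have cTd := is_derive_trmx (cd s); have vTd := is_derive_trmx (vd s).
have cAd := is_derive_linear_mx (mulmxr A) (cd s).
have D := is_deriveD
  (is_deriveB (is_derive_mulmx (vd s) cTd) (is_derive_mulmx (cd s) vTd))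
  (is_deriveZ (2 * (alpha - 1)) (is_derive_mulmx cAd cTd)).
exact: D.
Qed.

Lemma geodesic_linear_ode t : v t = Om *m c t + c t *m ((1 - 2 * alpha) *: A).
Proof.
rewrite -(geodesic_momentum t) scalemxrA -(geodesic_body_velocity t).
by rewrite stiefel_momentumE.
Qed.

Lemma geodesic_expm t :
  c t = expm (t *: Om) *m c 0 *m expm (t *: ((1 - 2 * alpha) *: A)).
Proof.
apply: two_sided_linear_ode => s; rewrite -geodesic_linear_ode; exact: cd.
Qed.

Lemma geodesic_velocity_expm t :
  v t = expm (t *: Om) *m v 0 *m expm (t *: ((1 - 2 * alpha) *: A)).
Proof.
rewrite geodesic_linear_ode (geodesic_expm t) (geodesic_linear_ode 0).
set B := _ *: A.
rewrite mulmxDr mulmxDl !mulmxA expm_comm; congr (_ + _).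
by rewrite -!mulmxA expm_comm.
Qed.

Definition frame_operator (W : 'M[K]_(n, d)) : 'M[K]_(n, d) :=
  - (Om *m W) - W *m ((1 - 2 * alpha) *: A) -
  stiefel_christoffel alpha (c 0) (v 0) W.

(** The curve and its velocity are moved by the isometries
    W |-> expm (t Om) W expm (t B), so the correction term is moved along with
    W; what the derivative of the two exponentials adds is constant too. *)
Lemma parallel_moving_frame (W : K -> 'M[K]_(n, d)) :
  smooth W ->
  (forall t, (c 0)^T *m W t + (W t)^T *m c 0 = 0) ->
  parallel_along M T nabla c
    (fun t => expm (t *: Om) *m W t *m expm (t *: ((1 - 2 * alpha) *: A))) <->
  forall t : K, is_derive t (1 : K) W (frame_operator (W t)).
Proof.
move=> Ws WT; set B := _ *: A.
have OmT : Om^T = - Om by exact: stiefel_momentum_skew.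
have AT : A^T = - A by rewrite /A -stiefel_tangentE.
have BT : B^T = - B by rewrite /B trmxZ AT scalerN.
pose E t := expm (t *: Om); pose F t := expm (t *: B).
have EE t : (E t)^T *m E t = 1%:M by exact: skew_expm_orthogonal.
have FF t : F t *m (F t)^T = 1%:M by apply/mulmx1C/skew_expm_orthogonal.
have EFcancel t (X : 'M[K]_(n, d)) : E t *m X *m F t = 0 -> X = 0.
  move=> H; rewrite -[X]mulmx1 -(FF t) -[X]mul1mx -(EE t).
  have -> : (E t)^T *m E t *m X *m (F t *m (F t)^T) =
            (E t)^T *m (E t *m X *m F t) *m (F t)^T by rewrite !mulmxA.
  by rewrite H mulmx0 mul0mx.
have Es : smooth E by exact: smooth_expm.
have Fs : smooth F by exact: smooth_expm.
rewrite (parallel_alongP alpha0 nablaLC _ cG.1).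
have Vs : smooth (fun t => E t *m W t *m F t).
  by apply: smooth_mulmx => //; exact: smooth_mulmx.
have VT : field_along T c (fun t => E t *m W t *m F t).
  split=> // t; rewrite geodesic_expm -/B -/(E t) -/(F t) /T /stiefel_tangent/=.
  rewrite !mx_expand !(mulmx_subst _ (EE t)) !mulmx1.
  have -> : (F t)^T *m (c 0)^T *m W t *m F t +
            (F t)^T *m (W t)^T *m c 0 *m F t =
     (F t)^T *m ((c 0)^T *m W t + (W t)^T *m c 0) *m F t by rewrite !mx_expand.
  by rewrite WT mulmx0 mul0mx.
have covE t : stiefel_covariant alpha c (fun t => E t *m W t *m F t) t =
    E t *m (derive1 W t - frame_operator (W t)) *m F t.
  rewrite /stiefel_covariant -/v geodesic_velocity_expm (geodesic_expm t) -/B.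
  rewrite -/(E t) -/(F t) christoffel_equivariant//.
  have D := is_derive_mulmx
    (is_derive_mulmx (is_derive_expm Om t) (smooth_is_derive1 t Ws))
    (is_derive_expm B t).
  rewrite (is_derive1E D) -/(E t) -/(F t).
  rewrite [_ *m E t](_ : _ = E t *m Om); last exact/esym/expm_comm.
  rewrite /frame_operator -/B.
  set G := stiefel_christoffel _ _ _ _; clearbody G.
  rewrite !mx_expand.
  mx_close.
split=> [[_ DV] t|Wd].
  have := smooth_is_derive1 t Ws.
  rewrite (_ : derive1 W t = frame_operator (W t))//.
  by apply/eqP; rewrite -subr_eq0; apply/eqP/(EFcancel t); rewrite -covE.
by split=> // t; rewrite covE (is_derive1E (Wd t)) subrr mulmx0 mul0mx.
Qed.

End Geodesics.

(** * Solution of the parallel equation in the moving frame *)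

Section TransportFormula.
Context (K : realType) (n d k : nat) (alpha : K).
Variables (Y xi eta : 'M[K]_(n, d)) (Q : 'M[K]_(n, k)) (A : 'M[K]_d)
  (R : 'M[K]_(k, d)).
Hypotheses (YY : Y^T *m Y = 1%:M) (QQ : Q^T *m Q = 1%:M) (YQ : Y^T *m Q = 0).
Hypotheses (AE : A = Y^T *m xi) (AT : A^T = - A) (xiE : xi = Y *m A + Q *m R).

Let QY : Q^T *m Y = 0.
Proof. by apply: trmx_inj; rewrite trmx_mul trmxK YQ trmx0. Qed.

Let P := @P_AR K d k alpha A R.

Lemma P_AR_linear : linear P.
Proof.
move=> a W Z; rewrite /P /P_AR /skew_part !linearP/= scale_col_mx add_col_mx.
congr col_mx; last first.
  by rewrite !mx_expand; mx_close.
by rewrite !mx_expand; mx_close.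
Qed.

HB.instance Definition _ := GRing.isLinear.Build K 'M[K]_(d + k, d)
  'M[K]_(d + k, d) _ P P_AR_linear.

Let Om := stiefel_momentum alpha Y xi.
(* the operator of the moving frame at Y, with velocity xi *)
Let L W := - (Om *m W) - W *m ((1 - 2 * alpha) *: A) -
  stiefel_christoffel alpha Y xi W.

(** The momentum at Y preserves the span of [Y|Q], because xi lies in it. *)
Lemma momentum_row_mx :
  Om *m row_mx Y Q = row_mx Y Q *m block_mx ((2 * alpha) *: A) (- R^T) R 0.
Proof.
rewrite mul_mx_row mul_row_block /Om /stiefel_momentum -AE xiE.
congr row_mx; rewrite !mx_expand.
  rewrite ?(mulmx_subst _ YY) ?(mulmx_subst _ QQ).
  rewrite ?(mulmx_subst _ YQ) ?(mulmx_subst _ QY).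
  rewrite ?mx_expand AT ?mx_expand.
  mx_close.
rewrite ?(mulmx_subst _ YY) ?(mulmx_subst _ QQ).
rewrite ?(mulmx_subst _ YQ) ?(mulmx_subst _ QY).
rewrite ?mx_expand.
mx_close.
Qed.

Section Orthogonal.
Variable (Z : 'M[K]_(n, d)).
Hypotheses (YZ : Y^T *m Z = 0) (QZ : Q^T *m Z = 0).

Lemma momentum_orthogonal : Om *m Z = 0.
Proof.
rewrite /Om /stiefel_momentum -AE xiE !mx_expand.
rewrite ?(mulmx_subst _ YZ) ?(mulmx_subst _ QZ) ?mx_expand.
mx_close.
Qed.

Lemma frame_operator_orthogonal : L Z = alpha *: (Z *m A).
Proof.
have ZY : Z^T *m Y = 0 by apply: trmx_inj; rewrite trmx_mul trmxK YZ trmx0.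
have xiZ : xi^T *m Z = 0.
  by rewrite xiE trmxD !trmx_mul mulmxDl -!mulmxA YZ QZ !mulmx0 addr0.
have Zxi : Z^T *m xi = 0 by apply: trmx_inj; rewrite trmx_mul trmxK xiZ trmx0.
have xiY : xi^T *m Y = - A by rewrite -[Y]trmxK -trmx_mul -AE AT.
rewrite /L momentum_orthogonal /stiefel_christoffel xiZ Zxi !mx_expand.
rewrite !(mulmx_subst _ xiY) !(mulmx_subst _ ZY) !mx_expand.
rewrite [Y *m Y^T *m Z](mulmx_subst _ YZ) !mx_expand.
mx_close.
Qed.

End Orthogonal.

(** The operator P_AR is what the moving-frame operator becomes in the
    coordinates given by [Y|Q].  Skewness of a enters through the terms
    a^T of the correction. *)
Lemma frame_operator_block (a : 'M[K]_d) (r : 'M[K]_(k, d)) : a^T = - a ->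
  L (row_mx Y Q *m col_mx a r) = row_mx Y Q *m P (col_mx a r).
Proof.
move=> aT; have xiY : xi^T *m Y = - A by rewrite -[Y]trmxK -trmx_mul -AE AT.
rewrite {1}/L mulmxA momentum_row_mx -mulmxA mul_block_col.
rewrite /P /P_AR col_mxKu col_mxKd /skew_part !mul_row_col.
have [W WE] : exists W, W = Y *m a + Q *m r by exists (Y *m a + Q *m r).
have YW : Y^T *m W = a by rewrite WE mulmxDr !mulmxA YY YQ mul1mx mul0mx addr0.
have WY : W^T *m Y = - a by rewrite -[Y]trmxK -trmx_mul YW.
have QW : Q^T *m W = r by rewrite WE mulmxDr !mulmxA QY QQ mul1mx mul0mx add0r.
have xiW : xi^T *m W = R^T *m r - A *m a.
  by rewrite xiE trmxD !trmx_mul mulmxDl -!mulmxA YW QW AT mulNmx addrC.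
have Wxi : W^T *m xi = r^T *m R - a *m A.
  apply: trmx_inj; rewrite trmx_mul trmxK xiW !trmxD !trmxN !trmx_mul !trmxK.
  by rewrite aT AT mulmxN mulNmx opprK.
rewrite -WE /stiefel_christoffel xiW Wxi !mx_expand.
rewrite !(mulmx_subst _ xiY) !(mulmx_subst _ WY).
rewrite !(mulmx_subst _ (esym AE)) !(mulmx_subst _ YW) xiE WE !mx_expand aT AT.
rewrite !mx_expand.
mx_close.
Qed.

Lemma frame_operator_linear : linear L.
Proof.
move=> a U U'; rewrite /L stiefel_christoffel_linear.
set G := stiefel_christoffel _ _ _ _; set G' := stiefel_christoffel _ _ _ _.
by rewrite !mx_expand; mx_close.
Qed.

HB.instance Definition _ := GRing.isLinear.Build K 'M[K]_(n, d)
  'M[K]_(n, d) _ L frame_operator_linear.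

Hypothesis etaT : stiefel_tangent Y eta.

Let w0 := (row_mx Y Q)^T *m eta.
Let Z := eta - Y *m Y^T *m eta - Q *m Q^T *m eta.

Lemma residual_orthogonal : Y^T *m Z = 0 /\ Q^T *m Z = 0.
Proof.
split; rewrite /Z !mx_expand.
  by rewrite YY YQ !mul0mx mul1mx subrr subr0.
by rewrite QY QQ !mul0mx mul1mx subr0 subrr.
Qed.

(** P_AR takes values with a skew upper block, so the symmetric part of the
    upper block is constant along the flow; it vanishes initially because eta
    is tangent. *)
Lemma expv_P_AR_skew t : (usubmx (expv t P w0))^T = - usubmx (expv t P w0).
Proof.
pose S s := usubmx (expv s P w0) + (usubmx (expv s P w0))^T.
have Sd (s : K) : is_derive s (1 : K) S 0.
  have D := is_derive_linear_mx (@usubmx K d k d) (is_derive_expv P w0 s).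
  have := is_deriveD D (is_derive_trmx D).
  by rewrite /P P_AR_skew addrN.
have S0 : S 0 = 0.
  rewrite /S expv0 /w0 tr_row_mx mul_col_mx col_mxKu trmx_mul trmxK.
  exact: etaT.
have /eqP := derive0_mx_cst Sd t 0; rewrite S0 /S addrC addr_eq0 => /eqP.
by [].
Qed.

(** The parallel field as seen in the moving frame. *)
Definition transport_frame (t : K) : 'M[K]_(n, d) :=
  row_mx Y Q *m expv t P w0 + Z *m expm (t *: (alpha *: A)).

Lemma transport_frame0 : transport_frame 0 = eta.
Proof.
rewrite /transport_frame expv0 scale0r expm0 mulmx1 /w0 tr_row_mx mul_col_mx.
by rewrite mul_row_col /Z !mulmxA; mx_close.
Qed.

Lemma transport_frame_tangent t :
  Y^T *m transport_frame t + (transport_frame t)^T *m Y = 0.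
Proof.
have [YZ _] := residual_orthogonal.
suff E : Y^T *m transport_frame t = usubmx (expv t P w0).
  have := congr1 trmx E; rewrite trmx_mul trmxK E => ->.
  by rewrite expv_P_AR_skew addrN.
rewrite /transport_frame mulmxDr [Y^T *m (Z *m _)]mulmxA YZ mul0mx addr0.
rewrite -{1}(vsubmxK (expv t P w0)) mulmxA mul_mx_row YY YQ mul_row_col.
by rewrite mul1mx mul0mx addr0.
Qed.

Lemma smooth_transport_frame : smooth transport_frame.
Proof.
apply: smoothD; apply: smooth_mulmx; try exact: smooth_cst.
  exact: smooth_expv.
exact: smooth_expm.
Qed.

Lemma is_derive_transport_frame (t : K) :
  is_derive t (1 : K) transport_frame (L (transport_frame t)).
Proof.
have [YZ QZ] := residual_orthogonal.
have D := is_deriveD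
  (is_derive_linear_mx (mulmx (row_mx Y Q)) (is_derive_expv P w0 t))
  (is_derive_linear_mx (mulmx Z) (is_derive_expm (alpha *: A) t)).
rewrite /transport_frame linearD/= -{1}(vsubmxK (expv t P w0)).
rewrite frame_operator_block; last exact: expv_P_AR_skew.
rewrite vsubmxK frame_operator_orthogonal; last 2 first.
- by rewrite mulmxA YZ mul0mx.
- by rewrite mulmxA QZ mul0mx.
have -> : alpha *: (Z *m expm (t *: (alpha *: A)) *m A) =
          Z *m (alpha *: A *m expm (t *: (alpha *: A))).
  by rewrite -expm_comm !scalemxrA mulmxA.
exact: D.
Qed.

Lemma transport_frame_unique (W : K -> 'M[K]_(n, d)) :
  W 0 = eta -> (forall t : K, is_derive t (1 : K) W (L (W t))) ->
  forall t, W t = transport_frame t.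
Proof.
move=> W0 Wd t.
have -> := linear_ode_expv Wd t.
have -> := linear_ode_expv is_derive_transport_frame t.
by rewrite W0 transport_frame0.
Qed.

(** On the span of [Y|Q] the exponential of the momentum is that of its block
    matrix, and the complementary summand is fixed; there the exponents
    alpha t and (1 - 2 alpha) t of A add up to (1 - alpha) t. *)
Lemma transport_formulaE t :
  expm (t *: Om) *m transport_frame t *m expm (t *: ((1 - 2 * alpha) *: A)) =
  row_mx Y Q *m expm (t *: block_mx ((2 * alpha) *: A) (- R^T) R 0)
    *m expv t (P_AR alpha A R) ((row_mx Y Q)^T *m eta)
    *m expm ((t * (1 - 2 * alpha)) *: A)
  + (eta - Y *m Y^T *m eta - Q *m Q^T *m eta)
    *m expm ((t * (1 - alpha)) *: A).
Proof.
have [YZ QZ] := residual_orthogonal.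
have bandE : expm (t *: Om) *m row_mx Y Q =
    row_mx Y Q *m expm (t *: block_mx ((2 * alpha) *: A) (- R^T) R 0).
  by apply: expm_intertwine; rewrite scalemxlA scalemxrA momentum_row_mx.
have restE : expm (t *: Om) *m Z = Z.
  rewrite (@expm_intertwine K _ _ _ (0 : 'M[K]_d) Z) ?expm0 ?mulmx1//.
  by rewrite scalemxlA momentum_orthogonal// scaler0 mulmx0.
have -> : (t * (1 - alpha)) *: A =
    t *: (alpha *: A) + t *: ((1 - 2 * alpha) *: A).
  by rewrite !scalerA -scalerDl; congr (_ *: _); ring.
rewrite !scalerA -scalerDl expmD /transport_frame -scalerA.
rewrite mulmxDr mulmxDl !mulmxA bandE restE !scalerA.
by [].
Qed.

End TransportFormula.

Theorem theorem5 (K : realType) (n d : nat) (hdn : (d < n)%N)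
    (alpha : K) (halpha : alpha != 0)
    (nabla : 'M[K]_(n, d) -> 'M[K]_(n, d) ->
             ('M[K]_(n, d) -> 'M[K]_(n, d)) -> 'M[K]_(n, d))
    (hnabla : levi_civita (@stiefel K n d) (@stiefel_tangent K n d)
                (@stiefel_metric K n d alpha) nabla)
    (Y xi : 'M[K]_(n, d))
    (hY : stiefel Y) (hxi : stiefel_tangent Y xi)
    (k : nat) (hk : k = \rank (xi - Y *m Y^T *m xi))
    (Q : 'M[K]_(n, k)) (hQorth : Q^T *m Q = 1%:M)
    (hQspan : (Q^T == (xi - Y *m Y^T *m xi)^T)%MS)
    (A : 'M[K]_d) (hA : A = Y^T *m xi)
    (R : 'M[K]_(k, d)) (hR : xi = Y *m A + Q *m R)
    (eta : 'M[K]_(n, d)) (heta : stiefel_tangent Y eta)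
    (gamma : K -> 'M[K]_(n, d))
    (hgamma : geodesic (@stiefel K n d) (@stiefel_tangent K n d) nabla gamma)
    (hgamma0 : gamma 0 = Y) (hdgamma0 : derive1 gamma 0 = xi)
    (Delta : K -> 'M[K]_(n, d)) :
  parallel_transport (@stiefel K n d) (@stiefel_tangent K n d)
    nabla gamma eta Delta <->
  (forall t : K,
    Delta t =
      row_mx Y Q
        *m expm (t *: block_mx ((2 * alpha) *: A) (- R^T) R 0)
        *m expv t (P_AR alpha A R) ((row_mx Y Q)^T *m eta)
        *m expm ((t * (1 - 2 * alpha)) *: A)
      + (eta - Y *m Y^T *m eta - Q *m Q^T *m eta)
        *m expm ((t * (1 - alpha)) *: A)).
Proof.
have YY : Y^T *m Y = 1%:M by [].
have AT : A^T = - A by rewrite hA -stiefel_tangentE.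
(* the columns of Q lie in the image of I - Y Y^T *)
have YQ : Y^T *m Q = 0.
  have /andP[/submxP[C QE] _] := hQspan.
  rewrite -[Q]trmxK QE trmx_mul trmxK mulmxA mulmxBr !mulmxA YY mul1mx subrr.
  by rewrite mul0mx.
pose Om := stiefel_momentum alpha Y xi; pose B := (1 - 2 * alpha) *: A.
pose W0 := transport_frame alpha Y eta Q A R.
have OmT : Om^T = - Om by exact: stiefel_momentum_skew.
have BT : B^T = - B by rewrite /B trmxZ AT scalerN.
pose E t := expm (t *: Om); pose F t := expm (t *: B).
have EE t : E t *m (E t)^T = 1%:M by apply/mulmx1C/skew_expm_orthogonal.
have FF t : (F t)^T *m F t = 1%:M by exact: skew_expm_orthogonal.
have EE' t : (E t)^T *m E t = 1%:M by exact/mulmx1C.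
have FF' t : F t *m (F t)^T = 1%:M by exact/mulmx1C.
have frameE (W : K -> 'M[K]_(n, d)) : smooth W ->
    (forall t, Y^T *m W t + (W t)^T *m Y = 0) ->
    parallel_along (@stiefel K n d) (@stiefel_tangent K n d) nabla gamma
      (fun t => E t *m W t *m F t) <->
    forall t : K, is_derive t (1 : K) W
      (- (Om *m W t) - W t *m B - stiefel_christoffel alpha Y xi (W t)).
  move=> Ws WT; have := parallel_moving_frame halpha hnabla hgamma Ws.
  by rewrite /frame_operator hgamma0 hdgamma0 -hA => /(_ WT).
have formulaE t := transport_formulaE alpha eta YY hQorth YQ hA AT hR t.
split=> [[DP D0] t|DE].
- rewrite -formulaE -/(E t) -/(F t).
  (* Delta in the moving frame *)
  pose W s := (E s)^T *m Delta s *m (F s)^T.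
  have DW s : Delta s = E s *m W s *m F s.
    rewrite /W !mulmxA EE mul1mx -mulmxA FF mulmx1.
    by [].
  have [[Ds DT] _] := DP.
  have Ws : smooth W.
    have sE p (C : 'M[K]_p) : smooth (fun s : K => expm (s *: C)).
      exact: smooth_expm.
    apply: smooth_mulmx; last by apply: smooth_trmx; exact: sE.
    by apply: smooth_mulmx => //; apply: smooth_trmx; exact: sE.
  have WT s : Y^T *m W s + (W s)^T *m Y = 0.
    have H : (F s)^T *m (Y^T *m W s + (W s)^T *m Y) *m F s = 0.
      have := DT s; rewrite /stiefel_tangent/= DW.
      rewrite (geodesic_expm halpha hnabla hgamma) hgamma0 hdgamma0 -hA.
      rewrite -/Om -/B -/(E s) -/(F s) !mx_expand.
      by rewrite !(mulmx_subst _ (EE' s)) !mulmx1.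
    have : F s *m ((F s)^T *m (Y^T *m W s + (W s)^T *m Y) *m F s)
             *m (F s)^T = 0.
      by rewrite H mulmx0 mul0mx.
    by rewrite !mulmxA FF' mul1mx -mulmxA FF' mulmx1.
  have /(frameE _ Ws WT) Wd : parallel_along (@stiefel K n d)
      (@stiefel_tangent K n d) nabla gamma (fun s => E s *m W s *m F s).
    by rewrite -(_ : Delta = fun s => E s *m W s *m F s)//; apply/funext.
  have Weta : W 0 = eta.
    by rewrite /W /E /F !scale0r !expm0 !trmx1 mulmx1 mul1mx.
  by rewrite DW (transport_frame_unique YY hQorth YQ hA AT hR heta Weta Wd).
- have -> : Delta = fun t => E t *m W0 t *m F t.
    by apply/funext => t; rewrite DE -formulaE.
  split.
    apply/frameE => [|t|t]; first exact: smooth_transport_frame.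
      exact: transport_frame_tangent.
    exact: is_derive_transport_frame.
  by rewrite /E /F !scale0r !expm0 mulmx1 mul1mx /W0 transport_frame0.
Qed.
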